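(* There exist universal constants $c,c'>0$ such that the following holds. Let $n\in\mathbb{N}$, $\sigma^2>0$, $0<\tau_1\le\dots\le\tau_n$, $L,\Delta>0$ and $0<\varepsilon\le c'L\Delta$. Let $A=\{A_d\}_{d\in\mathbb{N}}$ be a family of zero-respecting algorithms for the time multiple oracles protocol. Then there exist $d\in\mathbb{N}$, differentiable functions $f_1,\dots,f_n:\mathbb{R}^d\to\mathbb{R}$ with $f=\frac1n\sum_{i=1}^nf_i\in\mathcal{F}_{\Delta,L}$, and an admissible choice of oracles and distributions from $\mathcal{O}^{\sigma^2,\mathrm{heterog}}_{\tau_1,\dots,\tau_n}(f_1,\dots,f_n)$ such that, when $A_d$ is run in the protocol, $$\mathbb{E}\Big[\inf_{k\in S_t}\|\nabla f(x^k)\|^2\Big]>\varepsilon\quad\text{for}\quad t=c\left(\tau_n\frac{L\Delta}{\varepsilon}+\Big(\frac1n\sum_{i=1}^n\tau_i\Big)\frac{\sigma^2L\Delta}{n\varepsilon^2}\right).$$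
   Context: Notation: $[n]=\{1,\dots,n\}$, $\mathbb{N}_0=\{0,1,2,\dots\}$; for $x\in\mathbb{R}^d$, $\mathrm{supp}(x)=\{i\in[d]: x_i\neq0\}$. Time multiple oracles protocol. There are $n$ oracles $O_1,\dots,O_n$ with distributions $\mathcal{D}_1,\dots,\mathcal{D}_n$ on a sample space $\mathbb{S}_\xi$. An algorithm is a sequence $A=\{A^k\}_{k\ge0}$ with $A^0\in\mathbb{R}_{\ge0}\times[n]\times\mathbb{R}^d$ and $A^k:(\mathbb{R}^d)^k\to\mathbb{R}_{\ge0}\times[n]\times\mathbb{R}^d$ for $k\ge1$, such that for all $k\ge1$ and all $g^1,\dots,g^k$ the first (time) component of $A^k(g^1,\dots,g^k)$ is at least the first component of $A^{k-1}(g^1,\dots,g^{k-1})$. Each oracle $i$ has a state in $\mathbb{R}_{\ge0}\times\mathbb{R}^d\times\{0,1\}$, initially $s_i^0=(0,0,0)$. Set $t^0=0$. For $k=0,1,2,\dots$: $(t^{k+1},i^{k+1},x^k)=A^k(g^1,\dots,g^k)$ ($=A^0$ for $k=0$); draw $\xi^{k+1}\sim\mathcal{D}_{i^{k+1}}$ independently of everything before; $(s^{k+1}_{i^{k+1}},g^{k+1})=O_{i^{k+1}}(t^{k+1},x^k,s^k_{i^{k+1}},\xi^{k+1})$, and $s^{k+1}_j=s^k_j$ for $j\ne i^{k+1}$. For $t\ge0$, $S_t=\{k\in\mathbb{N}_0: t^k\le t\}$. Delayed oracle. For $\tau>0$ and a mapping $G:\mathbb{R}^d\times\mathbb{S}_\xi\to\mathbb{R}^d$,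 the oracle $O^G_\tau(t,x,(s_t,s_x,s_q),\xi)$ returns $((t,x,1),0)$ if $s_q=0$; $((s_t,s_x,1),0)$ if $s_q=1$ and $t<s_t+\tau$; $((0,0,0),G(s_x;\xi))$ if $s_q=1$ and $t\ge s_t+\tau$. Zero-respecting: an algorithm is zero-respecting if $\mathrm{supp}(x^k)\subseteq\bigcup_{j=1}^k\mathrm{supp}(g^j)$ for all $k\in\mathbb{N}_0$ and all realizations (so $x^0=0$). Function class $\mathcal{F}_{\Delta,L}$: differentiable $f:\mathbb{R}^d\to\mathbb{R}$ with $\|\nabla f(x)-\nabla f(y)\|\le L\|x-y\|$ for all $x,y$ and $f(0)-\inf_x f(x)\le\Delta$. Oracle class $\mathcal{O}^{\sigma^2,\mathrm{heterog}}_{\tau_1,\dots,\tau_n}(f_1,\dots,f_n)$: an admissible choice consists of a sample space, distributions $\mathcal{D}_1,\dots,\mathcal{D}_n$ and mappings $G_1,\dots,G_n:\mathbb{R}^d\times\mathbb{S}_\xi\to\mathbb{R}^d$ such that for all $x$ and $i$, $\mathbb{E}_{\xi\sim\mathcal{D}_i}[G_i(x;\xi)]=\nabla f_i(x)$ and $\mathbb{E}_{\xi\sim\mathcal{D}_i}\|G_i(x;\xi)-\nabla f_i(x)\|^2\le\sigma^2$; the oracles are $O_i=O^{G_i}_{\tau_i}$. *)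

(* Defs.v *)
From HB Require Import structures.
From mathcomp Require Import all_boot all_order all_algebra.
From mathcomp Require Import all_classical all_reals all_analysis.
Set Implicit Arguments. Unset Strict Implicit. Unset Printing Implicit Defensive.
Import Order.TTheory GRing.Theory Num.Theory.
Import numFieldNormedType.Exports.
Local Open Scope classical_set_scope.
Local Open Scope ring_scope.

Section Defs.
Variable R : realType.

Definition norm2 (d : nat) (x : 'rV[R]_d) : R := Num.sqrt (\sum_(j < d) (x 0 j) ^+ 2).

Definition grad (d : nat) (f : 'rV[R]_d -> R) (x : 'rV[R]_d) : 'rV[R]_d :=
  \row_(j < d) ('d f x (delta_mx 0 j : 'rV[R]_d)).

Definition avgf (n d : nat) (fs : 'I_n -> 'rV[R]_d -> R) : 'rV[R]_d -> R :=
  fun x => n%:R^-1 * \sum_(i < n) fs i x.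

(* the function class F_{Delta,L} ; f(0) - inf_x f(x) <= Delta is written out as
   "f(0) - f(x) <= Delta for all x" *)
Definition in_FDL (d : nat) (Delta L : R) (f : 'rV[R]_d -> R) : Prop :=
  (forall x, differentiable f x) /\
  (forall x y, norm2 (grad f x - grad f y) <= L * norm2 (x - y)) /\
  (forall x, f 0 - f x <= Delta).

(* An algorithm with n oracles in dimension d: A^k(g^1,...,g^k) = A [:: g^1; ...; g^k].
   Output: (time, oracle index, point). *)
Definition algorithm (n d : nat) := seq 'rV[R]_d -> (R * 'I_n * 'rV[R]_d)%type.

Definition alg_time n d (A : algorithm n d) s : R := (A s).1.1.
Definition alg_idx n d (A : algorithm n d) s : 'I_n := (A s).1.2.
Definition alg_pt n d (A : algorithm n d) s : 'rV[R]_d := (A s).2.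

Definition is_algorithm n d (A : algorithm n d) : Prop :=
  (forall s, 0 <= alg_time A s) /\
  (forall s g, alg_time A s <= alg_time A (rcons s g)).

Definition zero_respecting n d (A : algorithm n d) : Prop :=
  forall (s : seq 'rV[R]_d) (j : 'I_d),
    alg_pt A s 0 j != 0 -> exists2 g, g \in s & g 0 j != 0.

Definition ostate (d : nat) := (R * 'rV[R]_d * bool)%type.
Definition ostate0 (d : nat) : ostate d := (0, 0, false).

Definition delayed_oracle (d : nat) (S : Type) (tau : R) (G : 'rV[R]_d -> S -> 'rV[R]_d)
  (t : R) (x : 'rV[R]_d) (s : ostate d) (xi : S) : ostate d * 'rV[R]_d :=
  let: (st, sx, sq) := s in
  if ~~ sq then ((t, x, true), 0)
  else if t < st + tau then ((st, sx, true), 0)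
  else (ostate0 d, G sx xi).

(* ---------- the protocol ----------
   xi k i is the sample that is used at step k+1 if oracle i is called then
   (i.e. xi^{k+1} = xi k i^{k+1}).  run k = ([:: g^1; ...; g^k], states s^k). *)
Fixpoint run (n d : nat) (S : Type) (A : algorithm n d)
  (O : 'I_n -> R -> 'rV[R]_d -> ostate d -> S -> ostate d * 'rV[R]_d)
  (xi : nat -> 'I_n -> S) (k : nat) : seq 'rV[R]_d * ('I_n -> ostate d) :=
  match k with
  | 0 => ([::], fun _ => ostate0 d)
  | k'.+1 =>
      let: (gs, st) := run A O xi k' in
      let: (t, i, x) := A gs in
      let: (s', g) := O i t x (st i) (xi k' i) in
      (rcons gs g, fun j => if j == i then s' else st j)
  end.

Definition time_at n d S (A : algorithm n d) O (xi : nat -> 'I_n -> S) (k : nat) : R :=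
  match k with 0 => 0 | k'.+1 => alg_time A (run A O xi k').1 end.
Definition point_at n d S (A : algorithm n d) O (xi : nat -> 'I_n -> S) (k : nat) : 'rV[R]_d :=
  alg_pt A (run A O xi k).1.

Definition inf_sqgrad n d S (A : algorithm n d) O (xi : nat -> 'I_n -> S)
  (f : 'rV[R]_d -> R) (t : R) : R :=
  inf [set (norm2 (grad f (point_at A O xi k))) ^+ 2 | k in [set k | time_at A O xi k <= t]].

(* ---------- the oracle class O^{sigma^2,heterog}_{tau_1..tau_n}(f_1..f_n) ----------
   (the oracles themselves are O_i = delayed_oracle tau_i G_i) *)
Definition admissible (n d : nat) (dS : measure_display) (S : measurableType dS)
  (sigma2 : R) (fs : 'I_n -> 'rV[R]_d -> R) (D : 'I_n -> probability S R)
  (G : 'I_n -> 'rV[R]_d -> S -> 'rV[R]_d) : Prop :=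
  forall (i : 'I_n) (x : 'rV[R]_d),
    (forall j : 'I_d, (D i).-integrable setT (fun xi => (G i x xi 0 j)%:E)) /\
    (forall j : 'I_d, (\int[D i]_xi (G i x xi 0 j)%:E = (grad (fs i) x 0 j)%:E)%E) /\
    (\int[D i]_xi ((norm2 (G i x xi - grad (fs i) x)) ^+ 2)%:E <= sigma2%:E)%E.

Definition indep_draws (n : nat) (dO : measure_display) (Omega : measurableType dO)
  (P : probability Omega R) (dS : measure_display) (S : measurableType dS)
  (D : 'I_n -> probability S R) (xi : nat -> 'I_n -> Omega -> S) : Prop :=
  (forall k i, measurable_fun setT (xi k i)) /\
  (forall k i (B : set S), measurable B -> P (xi k i @^-1` B) = D i B) /\
  (forall (F : seq (nat * 'I_n)) (B : nat * 'I_n -> set S),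
     uniq F -> (forall p, measurable (B p)) ->
     P (\big[setI/setT]_(p <- F) (xi p.1 p.2 @^-1` B p)) =
     (\prod_(p <- F) P (xi p.1 p.2 @^-1` B p))%E).

End Defs.

(* Main.v *)
Require Import Defs.
From HB Require Import structures.
From mathcomp Require Import all_boot all_order all_algebra.
From mathcomp Require Import all_classical all_reals all_analysis.
From mathcomp Require Import measurable_realfun ring lra.
Set Implicit Arguments. Unset Strict Implicit. Unset Printing Implicit Defensive.
Import Order.TTheory GRing.Theory Num.Theory.
Import numFieldNormedType.Exports.
Local Open Scope classical_set_scope.
Local Open Scope ring_scope.

(** The coordinates are split into [n] blocks of length [T ~ L Delta / eps], and
    worker [i] owns a smooth zero-chain on block [i]: a function whose gradient at a
    point vanishing from position [m] of the block on vanishes from position [m + 1]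
    on, and stays bounded below as long as the last coordinate of the block is zero.
    Chain [i] is scaled so that it contributes at least [4 eps w_i] to the squared
    gradient norm of the average until it is completed, where the [w_i] sum to [1].
    Worker [i] reveals the next coordinate of its chain only with probability
    [p_i = min(1, 1024 n^2 eps w_i / sigma^2)], the smallest one that the variance
    budget allows.  By time [t] it returns at most [t / tau_i] gradients, so Markov's
    inequality bounds the probability that chain [i] is completed by
    [p_i t / (tau_i T)].  If [p_i B <= tau_i] for all [i], every chain is thus
    incomplete with probability at least [1/2] up to time [T B / 2], and linearity of
    expectation gives the bound [2 eps].  The two terms of the lower bound come from
    putting all the weight on the slowest worker ([B = tau_n]), respectively from
    [w_i] proportional to [tau_i]
    ([B = sigma^2 (tau_1 + ... + tau_n) / (1024 n^2 eps)]). *)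

(** * Piecewise quadratic building blocks *)

Section OneDim.
Variable R : realType.
Implicit Types u v : R.

Definition relu u : R := Num.max u 0.
Definition sqrelu u : R := relu u ^+ 2.

(** The quadratic spline rising from 0 at [u = 0] to 1 at [u = 1]; [dstep] is a tent of height 2
    with peak at [1/2]. Being a combination of shifts of [sqrelu], it inherits a single Taylor
    estimate. *)
Definition step u : R := 2 * (sqrelu u - 2 * sqrelu (u - 2^-1) + sqrelu (u - 1)).
Definition dstep u : R := 4 * (relu u - 2 * relu (u - 2^-1) + relu (u - 1)).

Lemma reluP u : (u <= 0 /\ relu u = 0) \/ (0 <= u /\ relu u = u).
Proof.
by rewrite /relu; case: (leP u 0) => h; [left|right; rewrite (ltW h)].
Qed.

Lemma relu_lip u v : `|relu u - relu v| <= `|u - v|.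
Proof.
case: (reluP u) => -[hu ->]; case: (reluP v) => -[hv ->];
  rewrite ler_norml; case: (ger0P (u - v)) => h; lra.
Qed.

Lemma sqrelu_taylor u v :
  `|sqrelu v - sqrelu u - (v - u) * (2 * relu u)| <= (v - u) ^+ 2.
Proof.
have := sqr_ge0 (v - u); rewrite /sqrelu ler_norml => H.
by case: (reluP u) => -[hu ->]; case: (reluP v) => -[hv ->]; apply/andP; split; nra.
Qed.

(** A quadratic remainder yields the derivative directly, with no gluing of pieces at the kinks. *)
Lemma is_derive_quadratic_error (f : R -> R) (C a u : R) :
  (forall v, `|f v - f u - (v - u) * a| <= C * (v - u) ^+ 2) -> is_derive u 1 f a.
Proof.
move=> fC.
have C0 : 0 <= C.
  by have := le_trans (normr_ge0 _) (fC (u + 1)); rewrite addrC addKr expr1n mulr1.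
have cv : (fun h : R => h^-1 *: ((f \o shift u) (h *: 1) - f u)) @ 0^' --> a.
  apply/cvgrPdist_le => /= e e0; near=> h.
  have h0 : h != 0 by near: h; exact: nbhs_dnbhs_neq.
  rewrite /= scaler1 distrC -(mulKf h0 a) -scalerBr normrZ normfV.
  rewrite ler_pdivrMl ?normr_gt0//.
  have := fC (h + u); rewrite addrK; move/le_trans; apply.
  rewrite -normr_id -real_normK ?num_real// normr_id expr2 mulrCA ler_wpM2l//.
  have : `|h| <= e / (C + 1).
    near: h; apply: dnbhs0_le; rewrite divr_gt0// ltr_wpDl//.
  rewrite ler_pdivlMr ?ltr_wpDl// => H; have := normr_ge0 h; nra.
split; [exact: cvgP cv|exact: cvg_lim cv].
Unshelve. all: by end_near. Qed.

Lemma is_derive_sqrelu u : is_derive u 1 sqrelu (2 * relu u).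
Proof.
apply: (@is_derive_quadratic_error _ 1) => v; rewrite mul1r; exact: sqrelu_taylor.
Qed.

Lemma is_derive_step u : is_derive u 1 step (dstep u).
Proof.
(* [8 = 2 * (1 + 2 + 1)], the sum of the absolute coefficients of [step]. *)
apply: (@is_derive_quadratic_error _ 8) => v.
have := sqrelu_taylor u v.
have := sqrelu_taylor (u - 2^-1) (v - 2^-1).
have := sqrelu_taylor (u - 1) (v - 1).
rewrite /step /dstep.
have -> : v - 2^-1 - (u - 2^-1) = v - u by lra.
have -> : v - 1 - (u - 1) = v - u by lra.
by rewrite !ler_norml; lra.
Qed.

Lemma stepE u :
  [\/ u <= 0 /\ (step u = 0 /\ dstep u = 0),
   [/\ 0 <= u, u <= 2^-1, step u = 2 * u ^+ 2 & dstep u = 4 * u],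
   [/\ 2^-1 <= u, u <= 1, step u = 1 - 2 * (1 - u) ^+ 2 & dstep u = 4 * (1 - u)] |
   1 <= u /\ (step u = 1 /\ dstep u = 0)].
Proof.
rewrite /step /dstep /sqrelu.
have [h|h] := reluP u; have [h1|h1] := reluP (u - 2^-1);
  have [h2|h2] := reluP (u - 1); case: h => h ->; case: h1 => h1 ->; case: h2 => h2 ->.
- by constructor 1; split; [|split]; lra.
- by exfalso; lra.
- by exfalso; lra.
- by exfalso; lra.
- by constructor 2; split; nra.
- by exfalso; lra.
- by constructor 3; split; nra.
- by constructor 4; split; [|split]; nra.
Qed.

Lemma step_bound u : 0 <= step u <= 1.
Proof. by case: (stepE u) => [[h [-> _]]|[h h' -> _]|[h h' -> _]|[h [-> _]]]; nra. Qed.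

Lemma dstep_bound u : 0 <= dstep u <= 2.
Proof. by case: (stepE u) => [[h [_ ->]]|[h h' _ ->]|[h h' _ ->]|[h [_ ->]]]; lra. Qed.

Lemma dstep_lip u v : `|dstep u - dstep v| <= 4 * `|u - v|.
Proof.
wlog uv : u v / v <= u.
  move=> W; case: (leP v u) => [/W//|/ltW/W]; by rewrite distrC (distrC u).
rewrite (@ger0_norm _ (u - v)) ?subr_ge0// ler_norml.
case: (stepE u) => [[h [_ ->]]|[h h' _ ->]|[h h' _ ->]|[h [_ ->]]];
case: (stepE v) => [[k [_ ->]]|[k k' _ ->]|[k k' _ ->]|[k [_ ->]]]; lra.
Qed.

Lemma step_lip u v : `|step u - step v| <= 2 * `|u - v|.
Proof.
wlog uv : u v / v <= u.
  move=> W; case: (leP v u) => [/W//|/ltW/W]; by rewrite distrC (distrC u).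
rewrite (@ger0_norm _ (u - v)) ?subr_ge0// ler_norml.
case: (stepE u) => [[h [-> _]]|[h h' -> _]|[h h' -> _]|[h [-> _]]];
case: (stepE v) => [[k [-> _]]|[k k' -> _]|[k k' -> _]|[k [-> _]]]; nra.
Qed.

Lemma step0 : step 0 = 0.
Proof. by case: (stepE 0) => [[_ [-> _]]|[]|[]|[]]//; lra. Qed.

Lemma dstep0 : dstep 0 = 0.
Proof. by case: (stepE 0) => [[_ [_ ->]]|[]|[]|[]]//; lra. Qed.

Lemma step_ge u : 4^-1 <= u -> 8^-1 <= step u.
Proof. by case: (stepE u) => [[h [-> _]]|[h h' -> _]|[h h' -> _]|[h [-> _]]]; nra. Qed.

Lemma dstep_ge1 u : 4^-1 <= u <= 3/4 -> 1 <= dstep u.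
Proof. by case: (stepE u) => [[h [_ ->]]|[h h' _ ->]|[h h' _ ->]|[h [_ ->]]]; lra. Qed.

End OneDim.

(** * The zero-chain *)

Section Chain.
Variables (R : realType) (T : nat).
Implicit Types y z : nat -> R.

(** The constant predecessor 1 at the start of a block sets the chain going and separates the
    blocks. *)
Definition chain_prev y k : R := if (T %| k)%N then 1 else y k.-1.

(* The penalty [sqrelu (- y k)] keeps the gradient away from [0] at negative [y k]. *)
Definition chain_term y k : R :=
  sqrelu (- y k) - step (chain_prev y k) * step (y k + 2^-1).

(** Only terms [k] and [k + 1] involve [y k]; this is, up to sign, the share of term [k + 1] in the
    partial derivative. *)
Definition chain_next y k : R :=
  if (T %| k.+1)%N then 0 else dstep (y k) * step (y k.+1 + 2^-1).

Definition chain_grad y k : R :=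
  - (2 * relu (- y k)) - step (chain_prev y k) * dstep (y k + 2^-1) - chain_next y k.

Lemma chain_term_ge y k : -1 <= chain_term y k.
Proof.
rewrite /chain_term /sqrelu; set p := step _; set q := step _.
have /andP[p0 p1] : 0 <= p <= 1 by exact: step_bound.
have /andP[q0 q1] : 0 <= q <= 1 by exact: step_bound.
have := sqr_ge0 (relu (- y k)); nra.
Qed.

Lemma chain_term0_le k : chain_term (fun _ => 0) k <= 0.
Proof.
rewrite /chain_term /sqrelu; set p := step _; set q := step _.
have /andP[p0 p1] : 0 <= p <= 1 by exact: step_bound.
have /andP[q0 q1] : 0 <= q <= 1 by exact: step_bound.
rewrite oppr0; have -> : relu (0 : R) = 0 by case: (@reluP R 0) => -[].
nra.
Qed.

Lemma mulr_lip (a b c e A C : R) : 0 <= a -> 0 <= e -> a <= A -> e <= C ->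
  `|a * c - b * e| <= A * `|c - e| + C * `|a - b|.
Proof.
move=> a0 e0 aA eC.
have -> : a * c - b * e = a * (c - e) + e * (a - b) by ring.
rewrite (le_trans (ler_normD _ _))// !normrM (ger0_norm a0) (ger0_norm e0).
by rewrite lerD// ler_wpM2r.
Qed.

(** The penalty, the middle product and [chain_next] contribute [2 + 4 + 4] to the factor of
    [|y k - z k|]; each neighbour gets only 4. *)
Lemma chain_grad_lip y z k :
  `|chain_grad y k - chain_grad z k| <=
   10 * ((if (T %| k)%N then 0 else `|y k.-1 - z k.-1|) + `|y k - z k| +
         (if (T %| k.+1)%N then 0 else `|y k.+1 - z k.+1|)).
Proof.
have prevE : `|step (chain_prev y k) - step (chain_prev z k)| <=
    2 * (if (T %| k)%N then 0 else `|y k.-1 - z k.-1|).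
  rewrite (le_trans (step_lip _ _))// /chain_prev.
  by case: ifP => _ //; rewrite subrr normr0.
have nextE : `|chain_next y k - chain_next z k| <=
   4 * `|y k - z k| + 4 * (if (T %| k.+1)%N then 0 else `|y k.+1 - z k.+1|).
  rewrite /chain_next; case: ifP => _.
    by rewrite subrr normr0 mulr0 addr0 mulr_ge0.
  have /andP[d0 d2] := dstep_bound (y k).
  have /andP[s0 s1] := step_bound (z k.+1 + 2^-1).
  have := mulr_lip (dstep (z k)) (step (y k.+1 + 2^-1)) d0 s0 d2 s1.
  have := dstep_lip (y k) (z k).
  have := step_lip (y k.+1 + 2^-1) (z k.+1 + 2^-1).
  rewrite (_ : y k.+1 + _ - _ = y k.+1 - z k.+1); last by ring.
  lra.
have midE : `|step (chain_prev y k) * dstep (y k + 2^-1) -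
     step (chain_prev z k) * dstep (z k + 2^-1)| <=
   4 * `|y k - z k| + 4 * (if (T %| k)%N then 0 else `|y k.-1 - z k.-1|).
  have /andP[d0 d2] := dstep_bound (z k + 2^-1).
  have /andP[s0 s1] := step_bound (chain_prev y k).
  have := mulr_lip (step (chain_prev z k)) (dstep (y k + 2^-1)) s0 d0 s1 d2.
  have := dstep_lip (y k + 2^-1) (z k + 2^-1).
  rewrite (_ : y k + _ - _ = y k - z k); last by ring.
  lra.
have rE : `|relu (- y k) - relu (- z k)| <= `|y k - z k|.
  by rewrite (le_trans (relu_lip _ _))// opprK addrC distrC.
move: prevE nextE midE rE; rewrite /chain_grad.
set A := if _ then _ else _; set B := if _ then _ else _.
set P := step _ * _; set P' := step _ * _; set N := chain_next y k.
set N' := chain_next z k; set r := relu _; set r' := relu _.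
have A0 : 0 <= A by rewrite /A; case: ifP.
have B0 : 0 <= B by rewrite /B; case: ifP.
have Y0 := normr_ge0 (y k - z k).
by rewrite !ler_norml; lra.
Qed.

(** The shift by [1/2] places [y k = 0] at the peak of [dstep], while [dstep 0 = 0] removes the
    influence of the next coordinate. *)
Lemma chain_grad_tail y k : y k = 0 ->
  chain_grad y k = - (2 * step (chain_prev y k)).
Proof.
move=> y0; rewrite /chain_grad /chain_next y0 dstep0 mul0r if_same oppr0 add0r.
have -> : relu (0 : R) = 0 by case: (@reluP R 0) => -[].
have -> : dstep (2^-1 : R) = 2.
  by case: (@stepE R 2^-1) => [[h [_ ->]]|[h h' _ ->]|[h h' _ ->]|[h [_ ->]]]; lra.
by rewrite mulr0 oppr0 add0r addr0 mulrC.
Qed.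

Lemma chain_grad_tail0 y k : ~~ (T %| k)%N -> y k = 0 -> y k.-1 = 0 ->
  chain_grad y k = 0.
Proof.
move=> Tk y0 yp; rewrite chain_grad_tail// /chain_prev (negbTE Tk) yp step0.
by rewrite mulr0 oppr0.
Qed.

(** All three summands of [chain_grad] are nonpositive, so nothing cancels: either [y k >= -1/4] and
    the factor [dstep] is at least 1, or the penalty alone gives [1/2]. *)
Lemma chain_grad_large y k : 4^-1 <= chain_prev y k -> y k < 4^-1 ->
  8^-1 <= `|chain_grad y k|.
Proof.
move=> hp hk.
have := step_ge hp; set p := step _ => p8.
have N0 : 0 <= chain_next y k.
  rewrite /chain_next; case: ifP => // _; apply: mulr_ge0.
    by case/andP: (dstep_bound (y k)).
  by case/andP: (step_bound (y k.+1 + 2^-1)).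
rewrite ler_normr; apply/orP; right; rewrite /chain_grad -/p.
have /andP[d0 _] := dstep_bound (y k + 2^-1).
have [hk'|hk'] := leP (- 4^-1) (y k).
  have : 1 <= dstep (y k + 2^-1) by apply: dstep_ge1; lra.
  have r0 : 0 <= relu (- y k) by case: (reluP (- y k)) => -[? ->].
  nra.
have : 4^-1 <= relu (- y k) by case: (reluP (- y k)) => -[? ->]; lra.
nra.
Qed.

(* The witness is the first index of the block at which [y < 1/4]. *)
Lemma chain_grad_block y b : (0 < T)%N -> y (b * T + T.-1)%N = 0 ->
  exists2 k, (k %/ T = b)%N & 8^-1 <= `|chain_grad y k|.
Proof.
move=> T0 y0.
have ex : exists j, (j < T)%N && (y (b * T + j)%N < 4^-1).
  by exists T.-1; rewrite y0 prednK// leqnn invr_gt0 ltr0n.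
case: (ex_minnP ex) => j /andP[jT yj] jmin.
exists (b * T + j)%N; first by rewrite divnMDl// divn_small// addn0.
apply: chain_grad_large => //.
rewrite /chain_prev; case: ifP => Tj; first by lra.
case: j => [|j] in jT yj jmin Tj *; first by rewrite addn0 dvdn_mull in Tj.
rewrite addnS /= leNgt; apply/negP => yj'.
by have := jmin j; rewrite yj' (ltnW jT) ltnn => /(_ isT).
Qed.

End Chain.

(** * Gradients of sums of chains *)

Section Coord.
Variables (R : realType) (d : nat).
Implicit Types x : 'rV[R]_d.

(** Extension by 0 to all of [nat] lets the neighbours [k.-1] and [k.+1] be read without bounds. *)
Definition coord_nat x (k : nat) : R := if insub k is Some j then x 0 j else 0.

Lemma coord_natE x (j : 'I_d) : coord_nat x j = x 0 j.
Proof. by rewrite /coord_nat valK. Qed.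

Lemma coord_natB x z k : coord_nat (x - z) k = coord_nat x k - coord_nat z k.
Proof. by rewrite /coord_nat; case: insub => [j|]; rewrite ?mxE ?subr0. Qed.

Lemma coord_nat0 k : coord_nat 0 k = 0.
Proof. by rewrite /coord_nat; case: insub => [j|//]; rewrite mxE. Qed.

Lemma coord_nat_delta (j : 'I_d) k : coord_nat (delta_mx 0 j) k = (k == j)%:R.
Proof.
rewrite /coord_nat; case: insubP => [i _ <-|]; first by rewrite mxE eqxx.
by case: eqP => // ->; rewrite ltn_ord.
Qed.

Lemma is_diff_coord_nat x k c :
  is_diff x (fun z => coord_nat z k * c) (fun v => coord_nat v k * c).
Proof.
rewrite /coord_nat; case: insub => [j|] /=; last first.
  rewrite mul0r.
  exact: is_diff_cst.
have flin : linear (fun N : 'rV[R]_d => N 0 j * c : R).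
  by move=> u y z; rewrite !mxE mulrDl -mulrA.
pose fM := GRing.isLinear.Build _ _ _ _ _ flin.
pose f : {linear _ -> _} := HB.pack (fun N : 'rV[R]_d => N 0 j * c : R) fM.
have cf : continuous f.
  move=> z; apply: (@continuousM _ _ (fun N : 'rV[R]_d => N 0 j) (cst c)).
    exact: coord_continuous.
  exact: cst_continuous.
have -> : (fun z : 'rV[R]_d => z 0 j * c) = f by [].
by apply: DiffDef; [exact/linear_differentiable|rewrite diff_lin].
Qed.

Lemma is_diff_comp1 (f df : 'rV[R]_d -> R) (g : R -> R) x a :
  is_diff x f df -> is_derive (f x) 1 g a -> is_diff x (g \o f) (fun v => df v * a).
Proof.
move=> hf [hg gE]; have dg : differentiable g (f x) by exact/derivable1_diffP.
have := is_diff_comp hf (differentiableP dg).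
by move/is_diff_eq; apply; apply/funext => v /=; rewrite diff1E// derive1E gE.
Qed.

Lemma norm2_sqr x : norm2 x ^+ 2 = \sum_(0 <= k < d) coord_nat x k ^+ 2.
Proof.
rewrite sqr_sqrtr ?sumr_ge0// => [|i _]; last exact: sqr_ge0.
by rewrite big_mkord; apply: eq_bigr => j _; rewrite coord_natE.
Qed.

End Coord.

(** * Block-scaled sums of chain terms: gradient and smoothness *)

Section BlockFun.
Variables (R : realType) (T d : nat).
Hypothesis T0 : (0 < T)%N.
Hypothesis Td : (T %| d)%N.
Implicit Types (a lam : nat -> R) (x v : 'rV[R]_d).

(** Here [k] selects the scale and [l] the coordinate, so all entries read by term [k] share the
    scale of its block. A scale 0 makes them 0, as [0^-1 = 0]. *)
Definition scaled lam x (k l : nat) : R := coord_nat x l * (lam (k %/ T)%N)^-1.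

Definition block_fun lam a x : R :=
  \sum_(k < d) a (k %/ T)%N * chain_term T (scaled lam x k) k.

Definition dchain_term (y v : nat -> R) (k : nat) : R :=
  - (v k * (2 * relu (- y k)))
  - (step (chain_prev T y k) * (v k * dstep (y k + 2^-1))
     + step (y k + 2^-1) * ((if (T %| k)%N then 0 else v k.-1 * dstep (y k.-1)))).

Lemma is_diff_chain_term lam x k :
  is_diff x (fun z => chain_term T (scaled lam z k) k)
   (fun v => dchain_term (scaled lam x k) (scaled lam v k) k).
Proof.
set c := (lam (k %/ T)%N)^-1.
have du l : is_diff x (fun z => scaled lam z k l) (fun v => scaled lam v k l).
  exact: is_diff_coord_nat.
have dneg : is_diff x (fun z => - scaled lam z k k) (fun v => - scaled lam v k k).
  exact: is_diffN.
have d1 := is_diff_comp1 dneg (is_derive_sqrelu _).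
have dsh : is_diff x (fun z => scaled lam z k k + 2^-1) (fun v => scaled lam v k k).
  have := is_diffD (du k) (is_diff_cst (2^-1 : R) x).
  by move/is_diff_eq; apply; apply/funext => v; rewrite fctE /= addr0.
have d2 := is_diff_comp1 dsh (is_derive_step _).
have d3 : is_diff x (fun z => step (chain_prev T (scaled lam z k) k))
    (fun v => if (T %| k)%N then 0 else scaled lam v k k.-1 * dstep (scaled lam x k k.-1)).
  rewrite /chain_prev; case: (T %| k)%N; first exact: is_diff_cst.
  exact: (is_diff_comp1 (du k.-1) (is_derive_step _)).
have := is_diffB d1 (is_diffM d3 d2).
move/is_diff_eq; apply; apply/funext => v /=.
by rewrite /dchain_term !fctE /= mulNr.
Qed.

Lemma is_diff_block_fun lam a x :
  is_diff x (block_fun lam a)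
   (fun v => \sum_(k < d) a (k %/ T)%N * dchain_term (scaled lam x k) (scaled lam v k) k).
Proof.
have H : forall (s : seq 'I_d), is_diff x
   (fun z => \sum_(k <- s) a (k %/ T)%N * chain_term T (scaled lam z k) k)
   (fun v => \sum_(k <- s) a (k %/ T)%N * dchain_term (scaled lam x k) (scaled lam v k) k).
  elim=> [|k s IH].
    under eq_fun do rewrite big_nil.
    under [X in is_diff _ _ X]eq_fun do rewrite big_nil.
    exact: is_diff_cst.
  under eq_fun do rewrite big_cons.
  under [X in is_diff _ _ X]eq_fun do rewrite big_cons.
  exact: (is_diffD (is_diffZ (a (k %/ T)%N) (is_diff_chain_term lam x k)) IH).
exact: H.
Qed.

Lemma grad_block_fun lam a x (j : 'I_d) :
  grad (block_fun lam a) x 0 j =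
  a (j %/ T)%N * (lam (j %/ T)%N)^-1 * chain_grad T (scaled lam x j) j.
Proof.
rewrite mxE; have -> := diff_val (is_diff_def := is_diff_block_fun lam a x).
pose A k : R := a (k %/ T)%N * (lam (k %/ T)%N)^-1 *
  (- (2 * relu (- scaled lam x k k)) -
    step (chain_prev T (scaled lam x k) k) * dstep (scaled lam x k k + 2^-1)).
pose B k : R := a (k %/ T)%N * (lam (k %/ T)%N)^-1 *
  (step (scaled lam x k k + 2^-1) * dstep (scaled lam x k k.-1)).
(* In direction [j] only two terms respond: term [j] through its own coordinate, collected in [A],
   and term [j + 1] through its predecessor, collected in [B]. *)
transitivity (\sum_(k < d) (if k == j then A k else 0) -
   \sum_(k < d) (if (~~ (T %| k) && (k == j.+1 :> nat))%N then B k else 0)).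
  rewrite -sumrB; apply: eq_bigr => k _.
  rewrite /dchain_term /A /B -val_eqE /=.
  have -> : scaled lam (delta_mx 0 j) k k = (k == j :> nat)%:R * (lam (k %/ T)%N)^-1.
    by rewrite /scaled coord_nat_delta.
  have -> : (if (T %| k)%N then 0 else (scaled lam (delta_mx 0 j) k k.-1) *
      dstep (scaled lam x k k.-1)) =
     (if (~~ (T %| k) && (k == j.+1 :> nat))%N then
        (lam (k %/ T)%N)^-1 * dstep (scaled lam x k k.-1) else 0).
    rewrite /scaled coord_nat_delta; case: ifP => //= Tk.
    have -> : (k == j.+1 :> nat) = (k.-1 == j :> nat).
      by case: (val k) Tk => [|m]; rewrite ?dvdn0.
    by case: eqP => _; rewrite ?mul1r ?mul0r.
  by case: eqP => _; case: ifP => _; rewrite /= ?mulr1n ?mulr0n; ring.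
rewrite -big_mkcond big_pred1_eq /A.
have -> : (\sum_(k < d) (if (~~ (T %| k) && (k == j.+1 :> nat))%N then B k else 0)) =
   a (j %/ T)%N * (lam (j %/ T)%N)^-1 * chain_next T (scaled lam x j) j.
  rewrite /chain_next; case: ifP => Tj.
    rewrite mulr0 big1// => k _; case: ifP => // /andP[Tk /eqP kj].
    by rewrite kj Tj in Tk.
  (* Since [T] divides [d], an index [j + 1] that does not start a block is below [d], and its term
     is part of the sum. *)
  have jd : (j.+1 < d)%N.
    rewrite ltn_neqAle ltn_ord andbT; apply/eqP => jd; by rewrite jd Td in Tj.
  have E : (j.+1 %/ T = j %/ T)%N by rewrite divnS// Tj.
  rewrite (bigD1 (Ordinal jd))//= big1 ?addr0; last first.
    move=> k kj; case: ifP => // /andP[_ /eqP kj'].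
    by move/eqP: kj; case; apply/val_inj.
  by rewrite Tj eqxx /= /B /scaled E /=; ring.
by rewrite /chain_grad; ring.
Qed.

Lemma differentiable_block_fun lam a x : differentiable (block_fun lam a) x.
Proof. exact: (ex_diff (is_diff_def := is_diff_block_fun lam a x)). Qed.

(** Coordinate [k] of the gradient is Lipschitz in three neighbouring coordinates with constant
    [10 C]. By [(u + w + t)^2 <= 3 (u^2 + w^2 + t^2)], and as each of the three shifted sums is at
    most the full one, the squared constant is at most [100 * 3 * 3 = 30^2] times [C^2]. *)
Lemma grad_block_fun_lip lam a (C : R) : 0 <= C ->
  (forall b, `|a b * (lam b)^-1 * (lam b)^-1| <= C) ->
  forall x z, norm2 (grad (block_fun lam a) x - grad (block_fun lam a) z)
    <= 30 * C * norm2 (x - z).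
Proof.
move=> C0 aC x z.
rewrite -(@ler_pXn2r _ 2) ?nnegrE ?sqrtr_ge0//; last first.
  by rewrite !mulr_ge0 ?sqrtr_ge0.
rewrite exprMn !norm2_sqr.
pose e k : R := coord_nat (x - z) k ^+ 2.
(* As [0.-1 = 0], the value 0 at index 0 is set explicitly; otherwise [e 0] would be counted
   twice. *)
pose pr k : R := if (0 < k)%N then e k.-1 else 0.
have e0 k : 0 <= e k by exact: sqr_ge0.
have gradE k : (0 <= k < d)%N ->
   coord_nat (grad (block_fun lam a) x - grad (block_fun lam a) z) k ^+ 2
   <= 300 * C ^+ 2 * (pr k + e k + e k.+1).
  move=> /= kd.
  have gE w : coord_nat (grad (block_fun lam a) w) k =
     a (k %/ T)%N * (lam (k %/ T)%N)^-1 * chain_grad T (scaled lam w k) k.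
    exact: etrans (coord_natE _ (Ordinal kd)) (grad_block_fun lam a w (Ordinal kd)).
  rewrite coord_natB (f_equal2 (fun u v : R => u - v) (gE x) (gE z)) -mulrBr.
  set b := (k %/ T)%N; set y := scaled _ _ _; set y' := scaled _ _ _.
  set u := (if (0 < k)%N then `|coord_nat (x - z) k.-1| else 0).
  set w := `|coord_nat (x - z) k|; set t := `|coord_nat (x - z) k.+1|.
  have u0 : 0 <= u by rewrite /u; case: ifP.
  have w0 : 0 <= w by exact: normr_ge0.
  have t0 : 0 <= t by exact: normr_ge0.
  have yE l : `|y l - y' l| = `|coord_nat (x - z) l| * `|(lam b)^-1|.
    by rewrite /y /y' /scaled -mulrBl normrM coord_natB.
  have H : `|a b * (lam b)^-1 * (chain_grad T y k - chain_grad T y' k)| <=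
     C * (10 * (u + w + t)).
    rewrite normrM.
    have := chain_grad_lip T y y' k.
    set A := if _ then _ else _; set B := if _ then _ else _.
    have Au : A <= u * `|(lam b)^-1|.
      rewrite /A /u; case: ifP => Tk; first by case: ifP => _; rewrite ?mul0r ?mulr_ge0.
      by rewrite lt0n; case: eqP Tk => [->|_ _]; rewrite ?dvdn0 ?yE.
    have Bt : B <= t * `|(lam b)^-1|.
      by rewrite /B /t; case: ifP => Tk; rewrite ?mulr_ge0 ?yE.
    rewrite yE -/w => H.
    apply: (@le_trans _ _ (`|a b * (lam b)^-1| * (10 * (u + w + t) * `|(lam b)^-1|))).
      by rewrite ler_wpM2l// (le_trans H)//; lra.
    rewrite mulrCA -normrM [leRHS]mulrC ler_wpM2l//.
    by rewrite mulr_ge0// !addr_ge0.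
  have -> : pr k = u ^+ 2.
    by rewrite /pr /u /e; case: ifP => _; rewrite ?expr0n ?real_normK ?num_real.
  have -> : e k = w ^+ 2 by rewrite /w /e real_normK ?num_real.
  have -> : e k.+1 = t ^+ 2 by rewrite /t /e real_normK ?num_real.
  rewrite -real_normK ?num_real//.
  apply: (@le_trans _ _ ((C * (10 * (u + w + t))) ^+ 2)).
    by rewrite ler_pXn2r// ?nnegrE// (le_trans _ H).
  rewrite exprMn (_ : 300 * _ * _ = C ^+ 2 * (300 * (u ^+ 2 + w ^+ 2 + t ^+ 2))); last by ring.
  rewrite ler_wpM2l ?sqr_ge0//.
  have := sqr_ge0 (u - w); have := sqr_ge0 (u - t); have := sqr_ge0 (w - t); nra.
have S1 m : \sum_(0 <= k < m) pr k <= \sum_(0 <= k < m) e k.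
  case: m => [|m]; first by rewrite !big_geq.
  rewrite big_nat_recl// [leRHS]big_nat_recr//= /pr /= add0r.
  by rewrite lerDl.
have S2 : \sum_(0 <= k < d) e k.+1 <= \sum_(0 <= k < d) e k.
  have ed : e d = 0.
    by rewrite /e /coord_nat insubF ?ltnn// expr0n.
  have : \sum_(0 <= k < d.+1) e k = e 0%N + \sum_(0 <= k < d) e k.+1.
    by rewrite big_nat_recl.
  rewrite big_nat_recr//= ed addr0 => ->.
  by rewrite lerDr.
apply: (@le_trans _ _ (\sum_(0 <= k < d) (300 * C ^+ 2 * (pr k + e k + e k.+1)))).
  by apply: ler_sum_nat.
rewrite -mulr_sumr !big_split /=.
set E := \sum_(0 <= k < d) e k in S2 *.
have {}S1 := S1 d; rewrite -/E in S1 *.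
have -> : (30 * C) ^+ 2 * E = 300 * C ^+ 2 * (E + E + E) by ring.
have CC : 0 <= 300 * C ^+ 2 by exact: mulr_ge0 (ler0n _ _) (sqr_ge0 _).
exact: ler_wpM2l CC _ _ (lerD (lerD S1 (lexx E)) S2).
Qed.

End BlockFun.

(** * Progress of zero-respecting algorithms *)

Section Protocol.
Variables (R : realType) (n d T : nat).
Variable A : algorithm R n d.
Hypothesis hA : is_algorithm A.
Hypothesis hZ : zero_respecting A.
Variable tau : 'I_n -> R.
Variable G : 'I_n -> 'rV[R]_d -> bool -> 'rV[R]_d.
Variable i0 : 'I_n.
Hypothesis tau_gt0 : 0 < tau i0.

(** The measure of progress: at most [m] positions of the chain of block [i] have been
    discovered. *)
Definition block_tail0 (i : nat) (m : nat) (x : 'rV[R]_d) : Prop :=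
  forall j : 'I_d, (j %/ T = i)%N -> (m <= j %% T)%N -> x 0 j = 0.

Hypothesis G_other : forall i x b, i != i0 -> block_tail0 i0 0 (G i x b).
Hypothesis G_chain : forall x (b : bool) m, block_tail0 i0 m x -> block_tail0 i0 (m + b) (G i0 x b).

Local Notation O := (fun i => delayed_oracle (tau i) (G i)).
Implicit Types xi : nat -> 'I_n -> bool.

(* Oracle [i0] returns a stochastic gradient at step [k + 1]. *)
Definition completes xi k : bool :=
  let: (gs, st) := run A O xi k in
  [&& alg_idx A gs == i0, (st i0).2 & (st i0).1.1 + tau i0 <= alg_time A gs].

Definition completes_by t xi k : bool :=
  completes xi k && (time_at A O xi k.+1 <= t).

Definition progresses_by t xi k : bool := completes_by t xi k && xi k i0.

Lemma run_local xi xi' k : (forall l i, (l < k)%N -> xi l i = xi' l i) ->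
  run A O xi k = run A O xi' k.
Proof.
elim: k => //= k IH H; rewrite IH; last by move=> l i lk; apply: H; exact: ltnW.
case: (run _ _ _ _) => gs st; case: (A gs) => -[t i] x.
by rewrite H.
Qed.

(** Step [k + 1] is chosen from the first [k] answers, so the draw [xi k] is still fresh when it is
    settled whether that step completes. *)
Lemma completes_by_local t xi xi' k : (forall l i, (l < k)%N -> xi l i = xi' l i) ->
  completes_by t xi k = completes_by t xi' k.
Proof.
by move=> H; rewrite /completes_by /completes /time_at (run_local H).
Qed.

Lemma time_at_le xi k l : (k <= l)%N -> time_at A O xi k <= time_at A O xi l.
Proof.
move=> /subnK <-; elim: (l - k)%N => //= m /le_trans; apply.
case: (m + k)%N => [|p] /=; first by case: hA.
case: (run _ _ _ _) => gs st; case: (A gs) => -[t i] x.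
case: (delayed_oracle _ _ _ _ _ _) => s' g.
by case: hA => _; apply.
Qed.

(** Oracle [i0] handles one request at a time, each lasting at least [tau i0]. The second clause, on
    the start of the pending request, carries the induction. *)
Lemma completes_time xi k :
  let N := (\sum_(l < k) completes xi l)%N in
  N%:R * tau i0 <= time_at A O xi k /\
  (((run A O xi k).2 i0).2 -> N%:R * tau i0 <= ((run A O xi k).2 i0).1.1).
Proof.
elim: k => [|k]; first by rewrite /= big_ord0 mul0r.
move=> /=; have := @time_at_le xi k k.+1 (leqnSn k).
rewrite big_ord_recr /=; set c := completes xi k.
have : c = completes xi k by []; rewrite /completes; clearbody c; move: c.
set N := (\sum_(l < k) _)%N; case: (run A O xi k) => gs st /= c.
rewrite /alg_idx /alg_time; case: (A gs) => -[t i] x /= -> tt [IH1 IH2].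
have [ii|ii] := eqVneq i i0; last first.
  rewrite /= addn0; case: (delayed_oracle _ _ _ _ _ _) => s' g /=.
  by rewrite [i0 == i]eq_sym (negbTE ii); split => //; exact: le_trans IH1 tt.
subst i; rewrite /delayed_oracle; case: (st i0) IH2 => [[s sx] []] /= IH2; last first.
  by rewrite eqxx /= addn0; split => [|_]; exact: le_trans IH1 tt.
case: ltP => h /=; rewrite eqxx /= ?addn0 ?addn1; first by split => //; exact: le_trans IH1 tt.
split => //; apply: le_trans h.
by rewrite -natr1 mulrDl mul1r lerD2r IH2.
Qed.

Lemma completes_by_le t xi l : (completes_by t xi l <= completes xi l)%N.
Proof. by rewrite /completes_by; case: (completes xi l); rewrite ?leq_b1. Qed.

(** As times never decrease, the completions counted all occur up to the last step at time at most
    [t], where [completes_time] applies. *)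
Lemma sum_completes_by t xi K : 0 <= t ->
  (\sum_(l < K) completes_by t xi l)%:R * tau i0 <= t.
Proof.
move=> t0; elim: K => [|K IH]; first by rewrite /= big_ord0 mul0r.
rewrite big_ord_recr /=; have [h|h] := leP (time_at A O xi K.+1) t; last first.
  have -> : completes_by t xi K = false by rewrite /completes_by [X in _ && X]leNgt h andbF.
  by rewrite addn0.
apply: le_trans h; apply: le_trans (completes_time xi K.+1).1.
rewrite ler_pM2r// ler_nat big_ord_recr /= leq_add//.
  by apply: leq_sum => l _; exact: completes_by_le.
exact: completes_by_le.
Qed.

Lemma block_tail0_le m m' x : (m <= m')%N -> block_tail0 i0 m x -> block_tail0 i0 m' x.
Proof. by move=> mm H j ji /(leq_trans mm); exact: H. Qed.

Lemma zero_respecting_tail0 m s :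
  (forall g, g \in s -> block_tail0 i0 m g) -> block_tail0 i0 m (alg_pt A s).
Proof.
move=> H j ji mj; apply/eqP; apply: contraT => /hZ[g gs].
by rewrite (H g gs)// eqxx.
Qed.

(** A gradient is taken at the point stored with the request, hence the second clause. A positive
    draw at a completion advances the frontier by at most one. *)
Lemma run_tail0 xi k :
  let X := (\sum_(l < k) (completes xi l && xi l i0))%N in
  (forall g, g \in (run A O xi k).1 -> block_tail0 i0 X g) /\
  block_tail0 i0 X ((run A O xi k).2 i0).1.2.
Proof.
elim: k => [|k]; first by rewrite /= big_ord0; split => //= j _ _; rewrite mxE.
move=> /=; rewrite big_ord_recr /=; set c := completes xi k.
have : c = completes xi k by []; rewrite /completes; clearbody c; move: c.
set X := (\sum_(l < k) _)%N; case: (run A O xi k) => gs st /= c cE [IH1 IH2].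
move: cE; have := zero_respecting_tail0 IH1; rewrite /alg_pt /alg_idx /alg_time.
case: (A gs) => -[t i] x /= IHx ->.
have rc g (b : nat) : block_tail0 i0 (X + b) g ->
    forall g', g' \in rcons gs g -> block_tail0 i0 (X + b) g'.
  move=> gb g'; rewrite mem_rcons inE => /orP[/eqP ->//|/IH1].
  by apply: block_tail0_le; rewrite leq_addr.
have z0 m : block_tail0 i0 m 0 by move=> j _ _; rewrite mxE.
have [ii|ii] := eqVneq i i0; last first.
  rewrite /= -/(nat_of_bool false); case E: (delayed_oracle _ _ _ _ _ _) => [s' g] /=.
  rewrite [i0 == i]eq_sym (negbTE ii) addn0; split => //.
  have := rc g 0%N; rewrite addn0; apply.
  move: E; rewrite /delayed_oracle; case: (st i) => [[s sx] []] /=; last by case=> _ <-.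
  by case: ifP => _ [_ <-] //; apply: block_tail0_le (G_other _ _ ii).
subst i; rewrite /delayed_oracle; case: (st i0) IH2 => [[s sx] []] /= IH2; last first.
  rewrite eqxx /= addn0; split => //; have := rc 0 0%N; rewrite addn0; exact.
case: ltP => h /=; rewrite eqxx /= ?addn0.
  split => //; have := rc 0 0%N; rewrite addn0; exact.
split => //; apply: rc; exact: G_chain.
Qed.

Lemma point_tail0 t xi k : time_at A O xi k <= t ->
  block_tail0 i0 (\sum_(l < k) progresses_by t xi l)%N (point_at A O xi k).
Proof.
move=> h; rewrite (eq_bigr (fun l : 'I_k => (completes xi l && xi l i0 : nat))).
  exact: zero_respecting_tail0 (run_tail0 xi k).1.
move=> l _; rewrite /progresses_by /completes_by (le_trans _ h) ?andbT//.
exact: time_at_le.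
Qed.

End Protocol.

(** * Finitely many independent draws *)

Lemma measure_finType_bigcup (R : realType) (dO : measure_display)
  (Omega : measurableType dO) (P : {measure set Omega -> \bar R})
  (I : finType) (F : I -> set Omega) (Q : pred I) :
  (forall i, measurable (F i)) -> trivIset setT F ->
  (P (\bigcup_(i in [set i | Q i]) F i) = \sum_(i | Q i) P (F i))%E.
Proof.
move=> mF tF; rewrite measure_fin_bigcup//; [|exact: finite_finset|exact: sub_trivIset tF].
rewrite -[RHS]big_filter [RHS]fsbig_seq ?filter_uniq ?index_enum_uniq//.
by apply: eq_fsbigl; apply/seteqP; split => i /=;
  rewrite mem_filter mem_index_enum andbT.
Qed.

Section BoolDraws.
Variables (R : realType) (n : nat) (dO : measure_display) (Omega : measurableType dO).
Variables (P : probability Omega R) (D : 'I_n -> probability bool R).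
Variable (xi : nat -> 'I_n -> Omega -> bool).
Hypothesis hxi : indep_draws P D xi.

Definition draws (w : Omega) : nat -> 'I_n -> bool := fun l j => xi l j w.
Definition draws_event (Q : (nat -> 'I_n -> bool) -> bool) : set Omega :=
  [set w | Q (draws w)].

Definition depends_on_first (K : nat) (Q : (nat -> 'I_n -> bool) -> bool) :=
  forall x x', (forall l j, (l < K)%N -> x l j = x' l j) -> Q x = Q x'.

Local Notation pattern K := {ffun 'I_K * 'I_n -> bool}.

Definition extend K (a : pattern K) (l : nat) (j : 'I_n) : bool :=
  if insub l is Some l' then a (l', j) else false.

Definition draws_before K : seq (nat * 'I_n) :=
  [seq (val q.1, q.2) | q <- enum {: 'I_K * 'I_n}].

Definition cylinder K (a : pattern K) : set Omega :=
  \big[setI/setT]_(p <- draws_before K) (xi p.1 p.2 @^-1` [set extend a p.1 p.2]).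

Lemma mem_draws_before K l j : ((l, j) \in draws_before K) = (l < K)%N.
Proof.
apply/mapP/idP => [[[l' j'] _ [-> _]] /=|lK]; first exact: ltn_ord.
by exists (Ordinal lK, j) => //; rewrite mem_enum.
Qed.

Lemma uniq_draws_before K : uniq (draws_before K).
Proof.
rewrite map_inj_uniq ?enum_uniq// => -[l j] [l' j'] /= [ll' ->].
by congr (_, _); exact: val_inj.
Qed.

Lemma cylinderP K (a : pattern K) w :
  cylinder a w <-> forall l j, (l < K)%N -> xi l j w = extend a l j.
Proof.
rewrite /cylinder -bigcap_seq; split => [H l j lK|H [l j]] /=.
  by apply: (H (l, j)); rewrite /= mem_draws_before.
by rewrite mem_draws_before => /H.
Qed.

Lemma measurable_draw l j (B : set bool) : measurable (xi l j @^-1` B).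
Proof. by case: hxi => mxi _; rewrite -[_ @^-1` _]setTI; exact: mxi. Qed.

Lemma measurable_cylinder K (a : pattern K) : measurable (cylinder a).
Proof. by apply: bigsetI_measurable => p _; exact: measurable_draw. Qed.

Lemma trivIset_cylinder K : trivIset setT (@cylinder K).
Proof.
move=> a b _ _ [w [/cylinderP aw /cylinderP bw]].
apply/ffunP => -[l j].
have := aw l j (ltn_ord l); rewrite (bw l j (ltn_ord l)) /extend valK.
by move=> ->.
Qed.

(** Round [k] is not among the first [K], so the product formula applies to the list of draws with
    and without [(k, i)]; the comparison leaves the factor [D i [set true]]. *)
Lemma cylinder_indep K (a : pattern K) k i : (K <= k)%N ->
  (P (xi k i @^-1` [set true] `&` cylinder a) = D i [set true] * P (cylinder a))%E.
Proof.
move=> Kk; have [_ [hD hind]] := hxi.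
pose B (p : nat * 'I_n) := if p == (k, i) then [set true] else [set extend a p.1 p.2].
have kiF : (k, i) \notin draws_before K by rewrite mem_draws_before -leqNgt.
have BE p : p \in draws_before K -> B p = [set extend a p.1 p.2].
  by rewrite /B; case: eqP => // ->; rewrite (negbTE kiF).
have eqB : {in draws_before K, forall p,
    xi p.1 p.2 @^-1` B p = xi p.1 p.2 @^-1` [set extend a p.1 p.2]}.
  by move=> p /BE ->.
have := hind ((k, i) :: draws_before K) B.
rewrite /= kiF uniq_draws_before => /(_ isT (fun _ => I)).
rewrite !big_cons /= {1 3}/B eqxx hD//= => /[dup].
rewrite big_seq (eq_bigr (fun p => xi p.1 p.2 @^-1` [set extend a p.1 p.2])) -?big_seq//.
move=> -> _; congr (_ * _)%E.
rewrite [RHS](hind _ (fun p => [set extend a p.1 p.2])) ?uniq_draws_before//.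
by apply: eq_big_seq => p /eqB ->.
Qed.

(** Reduces probabilities of events settled by [K] rounds to finite sums over patterns, where
    independence for single cylinders is enough. *)
Lemma draws_event_cylinders K Q : depends_on_first K Q ->
  draws_event Q = \bigcup_(a in [set a : pattern K | Q (extend a)]) cylinder a.
Proof.
move=> QK; apply/seteqP; split => [w Qw|w [a /= Qa /cylinderP aw]]; last first.
  by rewrite /draws_event /= (QK _ (extend a)).
pose a : pattern K := [ffun p : 'I_K * 'I_n => xi p.1 p.2 w].
have aw l j : (l < K)%N -> xi l j w = extend a l j.
  by move=> lK; rewrite /extend insubT ffunE.
exists a; last exact/cylinderP.
by rewrite /= (QK _ (draws w))// => l j lK; rewrite -aw.
Qed.

Lemma measurable_draws_event K Q : depends_on_first K Q -> measurable (draws_event Q).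
Proof.
move=> /draws_event_cylinders ->; apply: fin_bigcup_measurable => // a _.
exact: measurable_cylinder.
Qed.

Lemma prob_draws_event K Q : depends_on_first K Q ->
  (P (draws_event Q) = (\sum_(a : pattern K | Q (extend a)) fine (P (cylinder a)))%:E)%E.
Proof.
move=> /draws_event_cylinders ->; rewrite measure_finType_bigcup//.
- rewrite -sumEFin; apply: eq_bigr => a _; rewrite fineK// fin_num_measure//.
  exact: measurable_cylinder.
- exact: measurable_cylinder.
- exact: trivIset_cylinder.
Qed.

Lemma prob_draws_event_indep K Q k i : depends_on_first K Q -> (K <= k)%N ->
  (P (draws_event (fun x => Q x && x k i)) = D i [set true] * P (draws_event Q))%E.
Proof.
move=> QK Kk.
have -> : draws_event (fun x => Q x && x k i) =
   \bigcup_(a in [set a : pattern K | Q (extend a)])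
      (xi k i @^-1` [set true] `&` cylinder a).
  rewrite -setI_bigcupr -draws_event_cylinders//; apply/seteqP.
  by split => w; rewrite /draws_event /=; [case/andP|move=> [xw ->]; exact: xw].
rewrite measure_finType_bigcup; first last.
- exact: trivIset_setIl (@trivIset_cylinder K).
- by move=> a; exact: measurableI (measurable_draw _ _ _) (measurable_cylinder a).
rewrite (draws_event_cylinders QK) measure_finType_bigcup; first last.
- exact: trivIset_cylinder.
- exact: measurable_cylinder.
rewrite ge0_sume_distrr//; apply: eq_bigr => a _; exact: cylinder_indep.
Qed.

End BoolDraws.

(** * Completion probability of a chain *)

Section ChainProgress.
Variables (R : realType) (n d T : nat).
Hypothesis T_gt0 : (0 < T)%N.
Variable A : algorithm R n d.
Hypothesis hA : is_algorithm A.
Variable tau : 'I_n -> R.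
Variable G : 'I_n -> 'rV[R]_d -> bool -> 'rV[R]_d.
Variable i0 : 'I_n.
Hypothesis tau_gt0 : 0 < tau i0.
Variables (dO : measure_display) (Omega : measurableType dO).
Variables (P : probability Omega R) (D : 'I_n -> probability bool R).
Variable (xi : nat -> 'I_n -> Omega -> bool).
Hypothesis hxi : indep_draws P D xi.
Variables (p t : R).
Hypothesis t_ge0 : 0 <= t.
Hypothesis Dp : D i0 [set true] = p%:E.

Local Notation completes_by := (completes_by A tau G i0 t).
Local Notation progresses_by := (progresses_by A tau G i0 t).

Definition chain_done K : set Omega :=
  draws_event xi (fun x => T <= \sum_(l < K) progresses_by x l)%N.

Lemma depends_on_first_le K K' Q : (K <= K')%N ->
  @depends_on_first n K Q -> depends_on_first K' Q.
Proof. by move=> KK H x x' xx; apply: H => l j /leq_trans/(_ KK); exact: xx. Qed.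

Lemma completes_by_depends l : depends_on_first l (completes_by ^~ l).
Proof. by move=> x x'; exact: completes_by_local. Qed.

Lemma progresses_by_depends l : depends_on_first l.+1 (progresses_by ^~ l).
Proof.
move=> x x' xx; rewrite /progresses_by xx//; congr (_ && _).
by apply: completes_by_depends => l' j ll; apply: xx; exact: ltnW.
Qed.

Lemma chain_done_depends K :
  depends_on_first K (fun x => T <= \sum_(l < K) progresses_by x l)%N.
Proof.
move=> x x' xx; congr (_ <= _)%N; apply: eq_bigr => l _; congr nat_of_bool.
by apply: progresses_by_depends => l' j ll; apply: xx; exact: leq_trans ll _.
Qed.

Lemma chain_done_markov K : (P (chain_done K) <= (p * t / (tau i0 * T%:R))%:E)%E.
Proof.
(* [mu] is the law of the first [K] draws; expectations become finite sums over patterns. *)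
pose mu (a : {ffun 'I_K * 'I_n -> bool}) : R := fine (P (cylinder xi a)).
have mu0 a : 0 <= mu a by exact/fine_ge0/measure_ge0.
have mu1 : \sum_a mu a = 1.
  have := prob_draws_event hxi (K := K) (Q := xpredT) (fun _ _ _ => erefl).
  rewrite (_ : draws_event _ _ = setT) ?probability_setT; last exact/seteqP.
  by move=> [] /esym.
have p0 : 0 <= p by rewrite -lee_fin -Dp measure_ge0.
rewrite (prob_draws_event hxi (@chain_done_depends K)) lee_fin.
have TR : 0 < T%:R :> R by rewrite ltr0n.
(* Whether step [l + 1] completes is settled before draw [l], so progress costs a factor [p] in
   expectation. *)
have step_mass (l : 'I_K) : \sum_a (progresses_by (extend a) l)%:R * mu a =
    p * \sum_a (completes_by (extend a) l)%:R * mu a.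
  have toE (Q : (nat -> 'I_n -> bool) -> bool) : depends_on_first K Q ->
      (P (draws_event xi Q) = (\sum_a (Q (extend a))%:R * mu a)%:E)%E.
    move=> /(prob_draws_event hxi) ->; congr EFin.
    rewrite big_mkcond; apply: eq_bigr => a _.
    by case: (Q _); rewrite ?mul1r ?mul0r.
  have := prob_draws_event_indep hxi i0 (@completes_by_depends l) (leqnn l).
  rewrite Dp toE; last exact: depends_on_first_le (ltn_ord l) (@progresses_by_depends l).
  rewrite toE; last exact: depends_on_first_le (ltnW (ltn_ord l)) (@completes_by_depends l).
  by rewrite -EFinM => -[].
rewrite ler_pdivlMr ?mulr_gt0//.
(* Markov's inequality: on [chain_done] at least [T] steps progress. *)
apply: (@le_trans _ _ (\sum_a (\sum_(l < K) progresses_by (extend a) l)%:R * mu a * tau i0)).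
  rewrite mulrCA mulrC -mulr_suml ler_pM2r// mulrC mulr_sumr big_mkcond /=.
  apply: ler_sum => a _; case: ifPn => h; last by rewrite mulr_ge0.
  by apply: ler_wpM2r; [exact: mu0|rewrite ler_nat].
have -> : \sum_a (\sum_(l < K) progresses_by (extend a) l)%:R * mu a * tau i0 =
    p * \sum_a ((\sum_(l < K) completes_by (extend a) l)%:R * tau i0) * mu a.
  rewrite -mulr_suml.
  under eq_bigr do rewrite natr_sum mulr_suml.
  rewrite exchange_big /=; under eq_bigr do rewrite step_mass.
  rewrite -mulr_sumr -mulrA exchange_big /=; congr (_ * _).
  rewrite mulr_suml; apply: eq_bigr => a _.
  by rewrite natr_sum !mulr_suml; apply: eq_bigr => l _; rewrite mulrAC.
(* Every single run has at most [t / tau i0] completions by time [t]. *)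
rewrite ler_wpM2l//; apply: (@le_trans _ _ (\sum_a t * mu a)).
  by apply: ler_sum => a _; apply: ler_wpM2r; [exact: mu0|exact: sum_completes_by].
by rewrite -mulr_sumr mu1 mulr1.
Qed.

Lemma chain_done_nd : nondecreasing_seq chain_done.
Proof.
apply/nondecreasing_seqP => K; apply/subsetPset => w.
by rewrite /chain_done /draws_event /= big_ord_recr /= => /leq_trans; apply; rewrite leq_addr.
Qed.

Lemma measurable_chain_done : measurable (\bigcup_K chain_done K).
Proof.
apply: bigcup_measurable => K _.
exact: (measurable_draws_event hxi (@chain_done_depends K)).
Qed.

(** The number of steps up to time [t] may be unbounded. The Markov bound is uniform in [K] and
    passes to the increasing union by continuity of the measure. *)
Lemma prob_chain_not_done : p * t <= 2^-1 * (tau i0 * T%:R) ->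
  ((2^-1)%:E <= P (~` (\bigcup_K chain_done K)))%E.
Proof.
move=> pt; rewrite probability_setC; last exact: measurable_chain_done.
have : (P (\bigcup_K chain_done K) <= (2^-1)%:E)%E.
  have cv := nondecreasing_cvg_mu (mu := P)
    (fun K => measurable_draws_event hxi (@chain_done_depends K))
    measurable_chain_done chain_done_nd.
  rewrite -(cvg_lim _ cv)//; apply: lime_le; first by apply/cvg_ex; eexists; exact: cv.
  apply: nearW => K /=; apply: le_trans (chain_done_markov K) _.
  by rewrite lee_fin ler_pdivrMr// mulr_gt0// ltr0n.
rewrite -[P _]fineK ?fin_num_measure//; last exact: measurable_chain_done.
by rewrite -EFinB !lee_fin; lra.
Qed.

End ChainProgress.

(** The integral is a supremum over simple functions, and those below [g] are below [f]. For [f]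
    stands later the infimum of the squared gradient norms, known through a pointwise bound. *)
Lemma ge0_integral_lower_bound (R : realType) (dO : measure_display)
  (Omega : measurableType dO) (P : {measure set Omega -> \bar R})
  (g f : Omega -> \bar R) :
  (forall w, 0 <= g w)%E -> (forall w, g w <= f w)%E ->
  (\int[P]_w g w <= \int[P]_w f w)%E.
Proof.
move=> g0 gf.
have f0 w : (0 <= f w)%E by exact: le_trans (g0 w) (gf w).
rewrite !ge0_integralE//= !patch_setT.
apply: le_ereal_sup => _ [h hg <-]; exists h => // w.
exact: le_trans (hg w) (gf w).
Qed.

(** * The hard instance *)

Lemma sum_blocks (R : realType) (n T : nat) (g : nat -> R) :
  \sum_(k < n * T) g (k %/ T)%N = T%:R * \sum_(b < n) g b.
Proof.
rewrite -(big_mkord xpredT (fun k => g (k %/ T)%N)) -(big_mkord xpredT g).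
elim: n => [|n IH]; first by rewrite mul0n !big_geq// mulr0.
rewrite (@big_cat_nat _ _ _ (n * T)%N)/= ?leq_mul2r ?leqnSn ?orbT//.
rewrite IH big_nat_recr//= mulrDr; congr (_ + _).
rewrite (eq_big_nat _ _ (F2 := fun=> g n)).
  by rewrite sumr_const_nat mulSn addnK mulr_natl.
move=> k /andP[h1 h2]; congr g.
have T0 : (0 < T)%N by rewrite lt0n; apply: contraTneq h2 => ->; rewrite muln0.
by apply/eqP; rewrite eqn_leq leq_divRL// h1 andbT -ltnS ltn_divLR.
Qed.

Section BernoulliIntegral.
Variables (R : realType) (p : R).
Hypothesis p01 : 0 <= p <= 1.

Lemma bernoulli_true : bernoulli_prob p [set true] = p%:E.
Proof.
rewrite bernoulli_probE// !diracE /= mem_set// memNset//.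
by rewrite mule1 mule0 adde0.
Qed.

Lemma bernoulli_integrable (h : bool -> R) :
  (bernoulli_prob p).-integrable setT (fun b => (h b)%:E).
Proof.
apply/integrableP; split=> //.
rewrite integral_bernoulli_prob//= -!EFinM -EFinD; exact: ltry.
Qed.

Lemma bernoulli_integralE (h : bool -> R) :
  (\int[bernoulli_prob p]_b (h b)%:E = (p * h true + (1 - p) * h false)%:E)%E.
Proof.
(* The formula for nonnegative integrands is applied to the positive and negative parts of [h];
   [maxE] recombines them. *)
have maxE (a : R) : Num.max a 0 - Num.max (- a) 0 = a.
  by case: (leP a 0); case: (leP (- a) 0); lra.
rewrite integralE !integral_bernoulli_prob// !funeposE !funenegE.
rewrite /= -!EFin_max -!EFinM -!EFinD; congr EFin.
rewrite -[X in _ = p * X + _]maxE -[X in _ = _ + _ * X]maxE /unstable.onem; ring.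
Qed.

End BernoulliIntegral.

(** The noise will have variance [c (1 - p) / p]: it is 0 when [p = 1], and otherwise
    [s p = M >= c]. *)
Lemma min_ratio_variance (R : realType) (c M s p : R) : 0 < s -> 0 <= c -> c <= M ->
  p = Num.min 1 (M / s) -> 0 <= p -> c * (1 - p) <= s * p.
Proof.
move=> s0 c0 cM ->; case: (leP 1 (M / s)) => _ q0; first by rewrite subrr mulr0 mulr1 ltW.
by rewrite [s * _]mulrC divfK ?gt_eqF//; nra.
Qed.

(** * Losses and noisy gradients *)

Section Instance.
Variables (R : realType) (n T : nat).
Hypotheses (n_gt0 : (0 < n)%N) (T_gt0 : (0 < T)%N).
Variables (L eps sigma2 : R) (w : nat -> R).
Hypotheses (L_gt0 : 0 < L) (eps_gt0 : 0 < eps) (sigma2_gt0 : 0 < sigma2).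
Hypothesis w_ge0 : forall b, 0 <= w b.

Local Notation d := (n * T)%N.
Local Notation vec := 'rV[R]_d.

(** The factor 480 makes an unfinished chain count [(480 / 30)^2 / 8^2 = 4] times [eps * w b]; in
    [height], the divisor 30 offsets the constant of [grad_block_fun_lip]. *)
Definition radius b : R := 480 * Num.sqrt (eps * w b) / L.
Definition height b : R := L * radius b ^+ 2 / 30.

Lemma eps_w_ge0 b : 0 <= eps * w b.
Proof. exact: mulr_ge0 (ltW eps_gt0) (w_ge0 b). Qed.

Lemma moment_ge0 b : 0 <= 1024 * n%:R ^+ 2 * (eps * w b).
Proof. exact: mulr_ge0 (mulr_ge0 (ler0n _ _) (sqr_ge0 _)) (eps_w_ge0 b). Qed.

Lemma radius_sqr b : (L * radius b) ^+ 2 = 480 ^+ 2 * (eps * w b).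
Proof.
have -> : L * radius b = 480 * Num.sqrt (eps * w b).
  by rewrite /radius mulrC divfK// gt_eqF.
by rewrite exprMn sqr_sqrtr ?eps_w_ge0.
Qed.

Lemma heightE b : height b = 16 * 480 * (eps * w b) / L.
Proof.
have L0 : L != 0 by rewrite gt_eqF.
apply: (mulfI L0); rewrite mulrC [RHS]mulrC divfK//.
have := radius_sqr b; rewrite exprMn /height => H.
have -> : L * radius b ^+ 2 / 30 * L = (L ^+ 2 * radius b ^+ 2) / 30 by ring.
by rewrite H; lra.
Qed.

Lemma height_radius b : height b * (radius b)^-1 = L * radius b / 30.
Proof.
rewrite /height; have [->|r0] := eqVneq (radius b) 0.
  by rewrite expr0n /= !(mulr0, mul0r).
by field.
Qed.

(** The factor [n] cancels the average, so the average carries every chain at its own [height]; the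
    price is the [n ^+ 2] in [accept_prob]. *)
Definition loss (i : 'I_n) : vec -> R :=
  block_fun T radius (fun b => if b == i then n%:R * height b else 0).

Lemma block_ltn (j : 'I_d) : (j %/ T < n)%N.
Proof. by rewrite ltn_divLR. Qed.

Lemma avgf_loss : avgf loss = block_fun T radius height :> (vec -> R).
Proof.
apply/funext => x; rewrite /avgf /loss /block_fun exchange_big /= mulr_sumr.
apply: eq_bigr => k _; rewrite -mulr_suml mulrA; congr (_ * _).
rewrite (bigD1 (Ordinal (block_ltn k)))//= eqxx big1 ?addr0.
  by rewrite mulKf// pnatr_eq0 -lt0n.
move=> i; rewrite -val_eqE /= => /negbTE ik; by rewrite eq_sym ik.
Qed.

Lemma grad_loss i (x : vec) j : grad (loss i) x 0 j =
  if (j %/ T == i)%N then n%:R * (L * radius i / 30) * chain_grad T (scaled T radius x j) j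
  else 0.
Proof.
rewrite grad_block_fun ?dvdn_mull//; case: eqP => [->|_]; last by rewrite !mul0r.
by rewrite -[_ * height i * _]mulrA height_radius.
Qed.

Lemma grad_avgf_loss (x : vec) j : grad (avgf loss) x 0 j =
  L * radius (j %/ T)%N / 30 * chain_grad T (scaled T radius x j) j.
Proof. by rewrite avgf_loss grad_block_fun ?dvdn_mull// height_radius. Qed.

(** Each term is at least -1, and at most 0 at the origin, so the gap is at most [T] times the sum
    of the heights, which is [T * 16 * 480 * eps / L]. Smoothness holds because
    [height b / radius b ^+ 2] is at most [L / 30]. *)
Lemma loss_in_FDL Delta : \sum_(i < n) w i = 1 -> T%:R * (16 * 480 * eps) <= L * Delta ->
  in_FDL Delta L (avgf loss).
Proof.
move=> w1 hT; rewrite avgf_loss; split; [|split].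
- move=> x; exact: differentiable_block_fun.
- have -> : L = 30 * (L / 30) by field.
  apply: grad_block_fun_lip; rewrite ?dvdn_mull ?divr_ge0 ?ltW//.
  move=> b; rewrite height_radius; have [->|r0] := eqVneq (radius b) 0.
    by rewrite invr0 mulr0 normr0 divr_ge0 ?ltW.
  have -> : L * radius b / 30 / radius b = L / 30 by field.
  by rewrite ger0_norm// divr_ge0 ?ltW.
- move=> x; rewrite /block_fun -sumrB.
  apply: (@le_trans _ _ (\sum_(k < d) height (k %/ T)%N)).
    apply: ler_sum => k _; rewrite -mulrBr.
    have h0 : 0 <= height (k %/ T)%N.
      exact: divr_ge0 (mulr_ge0 (ltW L_gt0) (sqr_ge0 _)) (ler0n _ _).
    have := chain_term_ge T (scaled T radius x k) k.
    have -> : scaled T radius (0 : vec) k = fun=> 0.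
      by apply/funext => l; rewrite /scaled coord_nat0 mul0r.
    have := chain_term0_le R T k; nra.
  rewrite sum_blocks; under eq_bigr do rewrite heightE.
  rewrite -mulr_suml -mulr_sumr -mulr_sumr w1 mulr1 mulrA.
  by rewrite ler_pdivrMr// [leRHS]mulrC.
Qed.

Definition zero_tail (x : vec) (j : 'I_d) : bool :=
  [forall k : 'I_d, ((k %/ T == j %/ T)%N && (j <= k)%N) ==> (x 0 k == 0)].

Definition accept_prob (i : 'I_n) : R :=
  Num.min 1 (1024 * n%:R ^+ 2 * (eps * w i) / sigma2).

(** Coordinates before the tail are returned exactly. Those in the tail, of which only the first can
    have a nonzero derivative, are kept on a positive draw and rescaled. *)
Definition noisy_grad (i : 'I_n) (x : vec) (b : bool) : vec :=
  \row_j (grad (loss i) x 0 j * if zero_tail x j then b%:R / accept_prob i else 1).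

Lemma accept_prob01 i : 0 <= accept_prob i <= 1.
Proof.
rewrite /accept_prob ge_min lexx andbT le_min ler01 /=.
exact: divr_ge0 (moment_ge0 i) (ltW sigma2_gt0).
Qed.

Lemma zero_tailP (x : vec) (j k : 'I_d) : zero_tail x j ->
  (k %/ T = j %/ T)%N -> (j <= k)%N -> x 0 k = 0.
Proof. by move=> /forallP/(_ k) + kj jk; rewrite kj jk eqxx => /eqP. Qed.

Lemma scaled_zero (x : vec) (j k : 'I_d) : x 0 k = 0 -> scaled T radius x j k = 0.
Proof. by move=> xk; rewrite /scaled coord_natE xk mul0r. Qed.

Lemma block_pred (j : 'I_d) : (0 < j %% T)%N ->
  exists k : 'I_d, [/\ val k = j.-1, (k %/ T = j %/ T)%N & (k %% T = (j %% T).-1)%N].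
Proof.
move=> jT; have j0 : (0 < j)%N by case: (val j) jT => //; rewrite mod0n.
have kd : (j.-1 < d)%N by rewrite (leq_ltn_trans (leq_pred j)).
have lt : ((j %% T).-1 < T)%N by rewrite (leq_ltn_trans (leq_pred _))// ltn_pmod.
have jE : (j.-1 = j %/ T * T + (j %% T).-1)%N.
  by rewrite {1}(divn_eq j T) -{1}(prednK jT) addnS.
exists (Ordinal kd); split => //=; rewrite jE.
  by rewrite divnMDl ?T_gt0 ?(divn_small lt) ?addn0.
by rewrite modnMDl modn_small.
Qed.

Lemma grad_loss_zero_tail i (x : vec) (j k : 'I_d) : zero_tail x j ->
  val k = j.-1 -> (k %/ T = j %/ T)%N -> (0 < j %% T)%N -> x 0 k = 0 ->
  grad (loss i) x 0 j = 0.
Proof.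
move=> zj kj kb jT xk; rewrite grad_loss; case: eqP => // ji.
rewrite chain_grad_tail0 ?mulr0//.
- by rewrite /dvdn -lt0n.
- by rewrite scaled_zero// (zero_tailP zj).
- by rewrite -kj scaled_zero.
Qed.

(** [1024 = (2 * 480 / 30)^2]: at a tail coordinate [chain_grad] has modulus at most 2. *)
Lemma grad_loss_sqr_le i (x : vec) (j : 'I_d) : zero_tail x j ->
  (grad (loss i) x 0 j) ^+ 2 <= 1024 * n%:R ^+ 2 * (eps * w i).
Proof.
move=> zj; rewrite grad_loss; case: eqP => [ji|_]; last first.
  by rewrite expr0n /=; exact: moment_ge0.
rewrite chain_grad_tail; last by rewrite scaled_zero// (zero_tailP zj).
set s := step _; have /andP[s0 s1] : 0 <= s <= 1 by exact: step_bound.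
have -> : (n%:R * (L * radius i / 30) * - (2 * s)) ^+ 2 =
   n%:R ^+ 2 * (L * radius i) ^+ 2 / 225 * s ^+ 2 by lra.
rewrite radius_sqr.
have -> : n%:R ^+ 2 * (480 ^+ 2 * (eps * w i)) / 225 =
   1024 * n%:R ^+ 2 * (eps * w i) by lra.
by apply: ler_piMr; [exact: moment_ge0|exact: exprn_ile1].
Qed.

Lemma noisy_grad_other (i0 i : 'I_n) (x : vec) b : i != i0 ->
  block_tail0 T i0 0 (noisy_grad i x b).
Proof.
move=> ii j ji _; rewrite mxE grad_loss ji; case: eqP => [H|_]; last by rewrite mul0r.
by move/eqP: ii; case; apply/val_inj.
Qed.

(** Positions from [m] on are in the tail: a draw [false] erases them all, and a draw [true] can
    reveal only position [m], as later derivatives vanish by the zero-chain property. *)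
Lemma noisy_grad_chain (i : 'I_n) (x : vec) (b : bool) m : block_tail0 T i m x ->
  block_tail0 T i (m + b) (noisy_grad i x b).
Proof.
move=> xm j ji mj; rewrite mxE.
have zj : zero_tail x j.
  apply/forallP => k; apply/implyP => /andP[/eqP kj jk]; apply/eqP.
  apply: xm; first by rewrite kj.
  have : (j %% T <= k %% T)%N.
    by move: jk; rewrite {1}(divn_eq j T) {1}(divn_eq k T) kj leq_add2l.
  by apply: leq_trans; apply: leq_trans mj; rewrite leq_addr.
rewrite zj; case: b mj => mj; last by rewrite mul0r mulr0.
rewrite addn1 in mj.
have [k [kj kb kT]] := block_pred (leq_ltn_trans (leq0n m) mj).
rewrite (grad_loss_zero_tail i zj kj kb) ?mul0r//; first exact: leq_ltn_trans mj.
by apply: xm; rewrite ?kb// kT -ltnS prednK// (leq_ltn_trans _ mj).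
Qed.

Lemma accept_prob0 i : accept_prob i = 0 -> w i = 0.
Proof.
rewrite /accept_prob; case: (leP 1 _) => [_ /eqP|_ /eqP]; first by rewrite oner_eq0.
rewrite mulf_eq0 invr_eq0 (gt_eqF sigma2_gt0) orbF mulf_eq0.
rewrite [X in _ || X]mulf_eq0 (gt_eqF eps_gt0) => /orP[|/eqP//].
by rewrite mulf_eq0 sqrf_eq0 !pnatr_eq0 (gtn_eqF n_gt0).
Qed.

(* At most one coordinate is randomized with a nonzero derivative. *)
Lemma noisy_grad_error (i : 'I_n) (x : vec) : exists2 c,
  0 <= c <= 1024 * n%:R ^+ 2 * (eps * w i) &
  forall b : bool, norm2 (noisy_grad i x b - grad (loss i) x) ^+ 2
    = c * (b%:R / accept_prob i - 1) ^+ 2.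
Proof.
have errE b j : (noisy_grad i x b - grad (loss i) x) 0 j =
   grad (loss i) x 0 j * if zero_tail x j then b%:R / accept_prob i - 1 else 0.
  have -> : (noisy_grad i x b - grad (loss i) x) 0 j =
     noisy_grad i x b 0 j - grad (loss i) x 0 j by rewrite [LHS]mxE [X in _ + X]mxE.
  rewrite {1}/noisy_grad [X in X - _]mxE; case: ifP => _; first by rewrite mulrBr mulr1.
  by rewrite mulr1 subrr mulr0.
have normE b : norm2 (noisy_grad i x b - grad (loss i) x) ^+ 2 =
   \sum_j (grad (loss i) x 0 j * if zero_tail x j then b%:R / accept_prob i - 1 else 0) ^+ 2.
  rewrite sqr_sqrtr ?sumr_ge0// => [|j _]; last exact: sqr_ge0.
  by apply: eq_bigr => j _; rewrite errE.
have M0 := moment_ge0 i.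
have [/existsP[j /andP[zj gj]]|none] :=
    boolP [exists j, zero_tail x j && (grad (loss i) x 0 j != 0)].
  exists ((grad (loss i) x 0 j) ^+ 2).
    by rewrite sqr_ge0 grad_loss_sqr_le.
  move=> b; rewrite normE (bigD1 j)//= zj exprMn big1 ?addr0// => k kj.
  case: ifP => zk; last by rewrite mulr0 expr0n.
  suff -> : grad (loss i) x 0 k = 0 by rewrite mul0r expr0n.
  apply/eqP/negPn/negP => gk.
  (* Both coordinates would lie in block [i]; the predecessor of the later one is in the tail of the
     earlier one, which forces the later derivative to be 0. *)
  have key (a b' : 'I_d) : zero_tail x a -> zero_tail x b' -> (a < b')%N ->
      grad (loss i) x 0 a != 0 -> grad (loss i) x 0 b' != 0 -> False.
    move=> za zb ab ga gb.
    have ai : (a %/ T = i)%N by move: ga; rewrite grad_loss; case: ifP => [/eqP//|_]; rewrite eqxx.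
    have bi : (b' %/ T = i)%N by move: gb; rewrite grad_loss; case: ifP => [/eqP//|_]; rewrite eqxx.
    have bT : (0 < b' %% T)%N.
      apply: leq_ltn_trans (leq0n (a %% T)) _.
      by move: ab; rewrite {1}(divn_eq a T) {1}(divn_eq b' T) ai bi ltn_add2l.
    have [c [cb cB cT]] := block_pred bT.
    move/eqP: gb; apply; apply: (grad_loss_zero_tail i zb cb cB bT).
    apply: (zero_tailP za); first by rewrite cB bi ai.
    by rewrite cb -ltnS prednK// (leq_ltn_trans _ ab).
  have [kj'|jk|/val_inj kj'] := ltngtP k j.
  - exact: (key k j).
  - exact: (key j k).
  - by rewrite kj' eqxx in kj.
exists 0; first by rewrite lexx M0.
move=> b; rewrite normE mul0r big1// => j _.
move/existsPn/(_ j): none; case: ifP => _ /=; last by rewrite mulr0 expr0n.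
by rewrite negbK => /eqP ->; rewrite mul0r expr0n.
Qed.

Lemma noisy_grad_admissible :
  admissible sigma2 loss (fun i => bernoulli_prob (accept_prob i)) noisy_grad.
Proof.
move=> i x; have p01 := accept_prob01 i; have /andP[p0 p1] := p01.
split; [|split].
- by move=> j; exact: bernoulli_integrable.
- move=> j; rewrite bernoulli_integralE//; congr EFin; rewrite !mxE.
  case: ifP => _; last by rewrite !mulr1 -mulrDl addrC subrK mul1r.
  rewrite mul0r mulr0 mulr0 addr0 mul1r mulrCA.
  (* At probability 0 the value [b%:R / 0 = 0] still gives the right mean, as [w i = 0] makes the
     gradient vanish. *)
  have [ap0|ap0] := eqVneq (accept_prob i) 0; last by rewrite divff// mulr1.
  have -> : 'd (loss i) x (delta_mx 0 j) = grad (loss i) x 0 j by rewrite mxE.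
  rewrite grad_loss; case: ifP => _; last by rewrite mul0r.
  by rewrite /radius accept_prob0// mulr0 sqrtr0 !(mulr0, mul0r).
- have [c /andP[c0 cM] cE] := noisy_grad_error i x.
  under eq_integral do rewrite cE.
  rewrite (bernoulli_integralE p01 (fun b : bool => c * (b%:R / accept_prob i - 1) ^+ 2)).
  rewrite lee_fin /= mul0r sub0r sqrrN expr1n mulr1.
  have [ap0|ap0] := eqVneq (accept_prob i) 0.
    have -> : c = 0.
      by apply: le_anti; rewrite c0 andbT; move: cM; rewrite accept_prob0// !mulr0.
    by rewrite !(mul0r, mulr0) addr0 ltW.
  have -> : accept_prob i * (c * (1 / accept_prob i - 1) ^+ 2) + (1 - accept_prob i) * c =
     c * (1 - accept_prob i) / accept_prob i by field.
  have pgt0 : 0 < accept_prob i by rewrite lt_neqAle eq_sym ap0.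
  rewrite ler_pdivrMr//; exact: min_ratio_variance sigma2_gt0 c0 cM erefl p0.
Qed.

(** The blocks contribute separately. In an unfinished one [chain_grad_block] finds a coordinate of
    modulus at least [1/8], and [(L * radius i / 30)^2 = 256 * (eps * w i)], where
    [256 / 64 = 4]. *)
Lemma grad_avgf_sqr_ge (x : vec) (good : pred 'I_n) :
  (forall i, good i -> block_tail0 T i T.-1 x) ->
  \sum_(i < n) (good i)%:R * (4 * (eps * w i)) <= norm2 (grad (avgf loss) x) ^+ 2.
Proof.
move=> hg; rewrite sqr_sqrtr ?sumr_ge0// => [|j _]; last exact: sqr_ge0.
rewrite (partition_big (fun j : 'I_d => Ordinal (block_ltn j)) xpredT)//=.
apply: ler_sum => i _.
case: (boolP (good i)) => gi; last first.
  by rewrite mul0r sumr_ge0// => j _; exact: sqr_ge0.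
rewrite mul1r.
have iT : (i * T + T.-1 < d)%N.
  have := ltn_ord i; rewrite -(leq_pmul2r T_gt0) mulSn => /(leq_trans _); apply.
  by rewrite addnC ltn_add2r prednK.
pose z := Ordinal iT.
have z0 : scaled T radius x z z = 0.
  apply: scaled_zero; apply: (hg i gi); rewrite /=.
    by rewrite divnMDl// divn_small ?addn0// prednK.
  by rewrite modnMDl modn_small// prednK.
(* The scale is constant on the block, so [chain_grad_block] applies to the one sequence [y]. *)
pose y := scaled T radius x (i * T)%N.
have yE k : (k %/ T = i)%N -> scaled T radius x k = y.
  by move=> ki; apply/funext => l; rewrite /y /scaled ki mulnK.
have [|k ki kge] := @chain_grad_block R T y i T_gt0.
  rewrite -(yE z) //=; by rewrite divnMDl// divn_small ?addn0// prednK.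
have kd : (k < d)%N.
  by have := ltn_ord i; rewrite -ki ltn_divLR.
rewrite (bigD1 (Ordinal kd)) /=; last by apply/eqP/val_inj.
apply: ler_wpDr; first by apply: sumr_ge0 => j _; exact: sqr_ge0.
rewrite grad_avgf_loss /= ki yE// -real_normK ?num_real// normrM exprMn.
have -> : `|L * radius i / 30| ^+ 2 = 256 * (eps * w i).
  rewrite real_normK ?num_real// expr_div_n radius_sqr; lra.
have := mulr_ge0 (ltW eps_gt0) (w_ge0 i).
set g := `|_| in kge *; set u := eps * w i => u0.
have : 64^-1 <= g ^+ 2 by nra.
nra.
Qed.

End Instance.

(** * Expected squared gradient norm up to time [t] *)

Section LowerBound.
Variables (R : realType) (n T : nat).
Hypotheses (n_gt0 : (0 < n)%N) (T_gt0 : (0 < T)%N).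
Variables (L eps sigma2 : R) (w tau : nat -> R).
Hypotheses (L_gt0 : 0 < L) (eps_gt0 : 0 < eps) (sigma2_gt0 : 0 < sigma2).
Hypothesis w_ge0 : forall b, 0 <= w b.
Hypothesis w_sum1 : \sum_(i < n) w i = 1.
Hypothesis tau_gt0 : forall i : 'I_n, 0 < tau i.+1.
Variable A : algorithm R n (n * T).
Hypotheses (hA : is_algorithm A) (hZ : zero_respecting A).

Local Notation ploss := (@loss R n T L eps w).
Local Notation prob := (accept_prob eps sigma2 w).
Local Notation noisy := (@noisy_grad R n T L eps sigma2 w).

Lemma expected_inf_sqgrad_gt (B t : R) (dO : measure_display)
    (Omega : measurableType dO) (P : probability Omega R)
    (xi : nat -> 'I_n -> Omega -> bool) :
  (forall i : 'I_n, prob i * B <= tau i.+1) -> 0 <= t -> t <= T%:R * B / 2 ->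
  indep_draws P (fun i : 'I_n => bernoulli_prob (prob i)) xi ->
  (eps%:E < \int[P]_x (inf_sqgrad A
     (fun i : 'I_n => delayed_oracle (tau i.+1) (noisy i))
     (fun k i => xi k i x) (avgf ploss) t)%:E)%E.
Proof.
move=> pB t0 tTB hxi.
pose tau' (i : 'I_n) := tau i.+1.
pose E (i : 'I_n) := ~` (\bigcup_K chain_done T A tau' noisy i xi t K).
have mE i : measurable (E i).
  by apply: measurableC; exact: (@measurable_chain_done _ _ _ T A tau' noisy i _ _ P _ xi hxi).
have PE i : ((2^-1)%:E <= P (E i))%E.
  have p01 := accept_prob01 eps_gt0 sigma2_gt0 w_ge0 i.
  apply: (@prob_chain_not_done _ _ _ T T_gt0 A hA tau' noisy i (tau_gt0 i) _ _ P _ xi hxi (prob i)) => //.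
    exact: bernoulli_true.
  have /andP[p0 _] := p01.
  have TR : 0 <= T%:R :> R by exact: ler0n.
  have := ler_wpM2l p0 tTB; have := ler_wpM2l TR (pB i); rewrite /tau'; lra.
pose c (i : 'I_n) : R := 4 * (eps * w i).
have c0 i : 0 <= c i by rewrite mulr_ge0// mulr_ge0// ltW.
(* On each outcome the unfinished chains bound the squared gradient from below by [g]; by linearity
   only the probability of each [E i] enters. *)
pose g x : \bar R := (\sum_(i < n) (c i)%:E * (\1_(E i) x)%:E)%E.
have g_ge0 x : (0 <= g x)%E.
  by apply: sume_ge0 => i _; rewrite -EFinM lee_fin mulr_ge0// indicE ler0n.
have intg : (\int[P]_x g x = \sum_(i < n) (c i)%:E * P (E i))%E.
  rewrite ge0_integral_sum//.
  - apply: eq_bigr => i _; rewrite ge0_integralZl ?lee_fin//.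
    + by rewrite integral_indic// setIT.
    + by apply/measurable_EFinP; exact: measurable_indic.
  - by move=> i; apply: measurable_funeM; apply/measurable_EFinP; exact: measurable_indic.
  - by move=> i x _; rewrite -EFinM lee_fin mulr_ge0// indicE ler0n.
apply: (@lt_le_trans _ _ (\int[P]_x g x)%E); last first.
  apply: ge0_integral_lower_bound => // x.
  rewrite /g; under eq_bigr do rewrite -EFinM.
  rewrite sumEFin lee_fin; apply: lb_le_inf.
    (* Step 0 has time 0, so the infimum is over a nonempty set. *)
    by eexists; exists 0%N => //=; exact: t0.
  move=> _ [k /= hk <-].
  have := @grad_avgf_sqr_ge R n T n_gt0 T_gt0 L eps w L_gt0 eps_gt0 w_ge0
     (point_at A (fun i : 'I_n => delayed_oracle (tau i.+1) (noisy i))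
        (fun k i => xi k i x) k) (fun i => x \in E i).
  move=> H; apply: le_trans (H _).
    by rewrite le_eqVlt; apply/orP; left; apply/eqP; apply: eq_bigr => i _;
      rewrite indicE mulrC.
  move=> i; rewrite inE => Ei j ji jT.
  have := @point_tail0 R n _ T A hA hZ tau' noisy i.
  move=> /(_ _ _ t (fun k i => xi k i x) k hk); apply => //.
  - by move=> i' y b ii; exact: noisy_grad_other.
  - by move=> y b m; exact: noisy_grad_chain.
  (* Fewer than [T] progressing steps leave the last position [T.-1] of the block undiscovered. *)
  apply: leq_trans jT; rewrite -ltnS prednK// ltnNge; apply/negP => Tk.
  by apply: Ei; exists k.
rewrite intg; apply: (@lt_le_trans _ _ (\sum_(i < n) (c i)%:E * (2^-1)%:E)%E).
  under eq_bigr do rewrite -EFinM.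
  have cE : \sum_(i < n) c i = 4 * eps by rewrite -!mulr_sumr w_sum1 mulr1.
  (* Half of the total weight [4 * eps] is still strictly above [eps]. *)
  have lt : eps < 4 * eps / 2 by rewrite ltr_pdivlMr// [eps * 2]mulrC ltr_pM2r// ltr_nat.
  by rewrite sumEFin lte_fin -mulr_suml cE; exact: lt.
by apply: lee_sum => i _; apply: lee_wpmul2l; rewrite ?lee_fin.
Qed.

End LowerBound.

(** * Choice of constants, chain length and weights *)

Theorem mainTheorem4 (R : realType) :
  exists c c' : R, 0 < c /\ 0 < c' /\
  forall (n : nat) (sigma2 : R) (tau : nat -> R) (L Delta eps : R),
    (0 < n)%N -> 0 < sigma2 ->
    (forall i, (1 <= i <= n)%N -> 0 < tau i) ->
    (forall i j, (1 <= i)%N -> (i <= j)%N -> (j <= n)%N -> tau i <= tau j) ->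
    0 < L -> 0 < Delta -> 0 < eps -> eps <= c' * L * Delta ->
    forall A : forall d : nat, algorithm R n d,
    (forall d, is_algorithm (A d) /\ zero_respecting (A d)) ->
    let t := c * (tau n * (L * Delta / eps)
                  + (n%:R^-1 * \sum_(i < n) tau i.+1) * (sigma2 * L * Delta / (n%:R * eps ^+ 2))) in
    exists (d : nat) (fs : 'I_n -> 'rV[R]_d -> R),
      (forall i x, differentiable (fs i) x) /\
      in_FDL Delta L (avgf fs) /\
      exists (dS : measure_display) (S : measurableType dS)
             (D : 'I_n -> probability S R) (G : 'I_n -> 'rV[R]_d -> S -> 'rV[R]_d),
        admissible sigma2 fs D G /\
        forall (dO : measure_display) (Omega : measurableType dO)
               (P : probability Omega R) (xi : nat -> 'I_n -> Omega -> S),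
          indep_draws P D xi ->
          (eps%:E < \int[P]_w (inf_sqgrad (A d)
                       (fun i : 'I_n => delayed_oracle (tau i.+1) (G i))
                       (fun k i => xi k i w) (avgf fs) t)%:E)%E.
Proof.
(* [N] is the factor in the condition [T%:R * (16 * 480 * eps) <= L * Delta] on the gap, and [U] the
   factor 1024 of [accept_prob]. *)
have [N [NE N_gt0]] : exists N : R, N = 16 * 480 /\ 0 < N.
  exists (16 * 480); split; first exact: erefl.
  by apply: mulr_gt0; rewrite ltr0n.
have [U [UE U_gt0]] : exists U : R, U = 1024 /\ 0 < U.
  by exists 1024; split; [exact: erefl|rewrite ltr0n].
have U1_gt0 : 0 < U + 1 by exact: addr_gt0.
(* Solves [K * (2 * N * T) * ((U + 1) * B) = T * B / 2]. *)
pose K := (N * 4 * (U + 1))^-1.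
have K_gt0 : 0 < K by rewrite invr_gt0; apply: mulr_gt0 U1_gt0; apply: mulr_gt0 N_gt0 _.
exists K, N^-1; split; [exact: K_gt0|split; first by rewrite invr_gt0].
move=> n sigma2 tau L Delta eps n_gt0 s_gt0 tau_gt0 tau_nd L_gt0 D_gt0 e_gt0 epsle A hA t.
pose Q := L * Delta / eps.
have Q_gt0 : 0 < Q by rewrite divr_gt0 ?mulr_gt0.
(* The choice [c' = N^-1] guarantees a chain of length at least 1. *)
have QN : 1 <= Q / N.
  rewrite ler_pdivlMr// mul1r /Q ler_pdivlMr//.
  by move: epsle; rewrite -mulrA ler_pdivlMl.
pose T := Num.truncn (Q / N).
have /andP[TQ QT] := truncn_itv (le_trans ler01 QN).
have T_gt0 : (0 < T)%N by rewrite -ltnS -(@ltr_nat R) (le_lt_trans QN).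
have T1 : 1 <= T%:R :> R by rewrite ler1n.
(* [Q / N < T + 1 <= 2 T]: rounding down loses at most a factor 2. *)
have TQ2 : Q <= 2 * N * T%:R.
  move: (ltW QT); rewrite -natr1 -/T ler_pdivrMr// => H.
  apply: (le_trans H); nra.
have TLD : T%:R * (16 * 480 * eps) <= L * Delta.
  by move: TQ; rewrite -NE -/T ler_pdivlMr// /Q ler_pdivlMr// mulrA.
have taupos (i : 'I_n) : 0 < tau i.+1 by apply: tau_gt0; rewrite /= ltn_ord.
pose S := \sum_(i < n) tau i.+1.
have S_gt0 : 0 < S.
  rewrite /S (bigD1 (Ordinal n_gt0))//= ltr_pwDl ?taupos//.
    exact: (taupos (Ordinal n_gt0)).
  by rewrite sumr_ge0// => i _; exact: ltW.
have nR : 0 < n%:R :> R by rewrite ltr0n.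
have taun : 0 < tau n by apply: tau_gt0; rewrite n_gt0 leqnn.
(* For [w] proportional to [tau], the untruncated probability of worker [i] times [B2] is exactly
   [tau i.+1]. *)
pose B2 := sigma2 * S / (U * n%:R ^+ 2 * eps).
have B2_gt0 : 0 < B2.
  exact: divr_gt0 (mulr_gt0 s_gt0 S_gt0) (mulr_gt0 (mulr_gt0 U_gt0 (exprn_gt0 _ nR)) e_gt0).
have tE : t = K * Q * (tau n + U * B2).
  by rewrite /t /Q /B2 -/S; field; rewrite !gt_eqF.
have UB2 : 0 < tau n + U * B2 by exact: addr_gt0 taun (mulr_gt0 U_gt0 B2_gt0).
have t_ge0 : 0 <= t.
  by rewrite tE; exact: ltW (mulr_gt0 (mulr_gt0 K_gt0 Q_gt0) UB2).
(* [B] is the larger of [tau n] and [B2], so that it dominates both terms of the time bound. *)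
have [w [B [w_ge0 w1 pB tB]]] : exists w B, [/\ forall b : nat, 0 <= w b :> R,
    \sum_(i < n) w i = 1,
    forall i : 'I_n, accept_prob eps sigma2 w i * B <= tau i.+1
    & tau n + U * B2 <= (U + 1) * B].
  have [h|h] := leP B2 (tau n).
    (* Index [n.-1] is the slowest worker, of delay [tau n]; the others get weight and probability
       0. *)
    exists (fun b => (b == n.-1)%:R), (tau n); split.
    - by move=> b; exact: ler0n.
    - have ln : (n.-1 < n)%N by rewrite prednK.
      rewrite (bigD1 (Ordinal ln))//= eqxx big1 ?addr0// => i.
      by rewrite -val_eqE /= => /negbTE ->.
    - move=> i; rewrite /accept_prob; case: eqP => [->|_].
        by rewrite prednK//; apply: ler_piMl; [exact: ltW|rewrite ge_min lexx].
      by rewrite mulr0 mulr0 mul0r min_r// mul0r; exact: ltW.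
    - by rewrite mulrDl mul1r addrC lerD2r; apply: ler_wpM2l h; exact: ltW.
  exists (fun b => if (b < n)%N then tau b.+1 / S else 0), B2; split.
  - move=> b; case: ifP => // bn; apply: divr_ge0; last exact: ltW.
    exact: ltW (taupos (Ordinal bn)).
  - under eq_bigr do rewrite ltn_ord.
    by rewrite -mulr_suml divff// gt_eqF.
  - move=> i; rewrite /accept_prob ltn_ord -UE.
    set M := _ / sigma2; have -> : tau i.+1 = M * B2.
      by rewrite /M /B2; field; rewrite !gt_eqF.
    by apply: ler_wpM2r; [exact: ltW|rewrite ge_min lexx orbT].
  - by rewrite mulrDl mul1r addrC lerD2l; exact: ltW.
have tTB : t <= T%:R * B / 2.
  rewrite tE; apply: (@le_trans _ _ (K * (2 * N * T%:R) * ((U + 1) * B))).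
    apply: ler_pM => //; [exact: ltW (mulr_gt0 K_gt0 Q_gt0)|exact: ltW|].
    by apply: ler_wpM2l => //; exact: ltW.
  have -> : K * (2 * N * T%:R) * ((U + 1) * B) = T%:R * B / 2.
    by rewrite /K; field; rewrite !gt_eqF.
  exact: lexx.
have [hA1 hZ1] := hA (n * T)%N.
exists (n * T)%N, (@loss R n T L eps w); split.
  by move=> i x; exact: differentiable_block_fun.
split; first exact: loss_in_FDL.
exists _, bool, (fun i : 'I_n => bernoulli_prob (accept_prob eps sigma2 w i)),
  (@noisy_grad R n T L eps sigma2 w).
split; first exact: noisy_grad_admissible.
move=> dO Omega P xi hxi.
exact: (@expected_inf_sqgrad_gt R n T n_gt0 T_gt0 L eps sigma2 w tau L_gt0 e_gt0
  s_gt0 w_ge0 w1 taupos (A (n * T)%N) hA1 hZ1 B t).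
Qed.
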